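(* Let $p$ be a prime, $n\ge 1$, and $d_1\geq d_2\ge\dots\geq d_n\geq 0$ integers. Let $M\in \mathcal{M}(p^{d_1},\dots,p^{d_n})$ and let $A=F_n/I_M$. Then $(A,r_{x+I_M})$ is a solution in $\mathbf{AbSol}(p^{d_1},\dots,p^{d_n})$, and every solution in $\mathbf{AbSol}(p^{d_1},\dots,p^{d_n})$ is isomorphic to such a solution (for some $M\in\mathcal{M}(p^{d_1},\dots,p^{d_n})$).
   Context: $\mathcal{M}(p^{d_1},\dots,p^{d_n})$ is the set of all $n\times n$ matrices $M$ such that: (1) $M$ is upper triangular; (2) all entries of $M$ are non-negative integers; (3) every diagonal element is strictly greater than every other element in the same column; (4) for every $1\le k\le n$, the image of the $k$-th row of $M$ under the shift $s^+(v_1,\dots,v_n)=(0,v_1,\dots,v_{n-1})$ lies in the subgroup of $\mathbb{Z}^n$ generated by the rows $k+1,\dots,n$ of $M$; (5) the diagonal of $M$ is $(p^{d_1},\dots,p^{d_n})$. $F_n$ is the (non-unital) subring of $\mathbb{Z}[x]/(x^{n+1})$ generated by $x$, so $F_n=\mathbb{Z}x\oplus\dots\oplus\mathbb{Z}x^n$. It is a brace with its addition and $a\circ b=a+ab+b$; brace ideals of $F_n$ are the same as ring ideals. $I_M$ is the additive subgroup of $F_n$ generated by the elements $\sum_{j=1}^n m_jx^j$ for $(m_1,\dots,m_n)$ a row of $M$; it is an ideal of $F_n$ for $M\in \mathcal{M}(p^{d_1},\dots,p^{d_n})$. A brace is a triple $(A,+,\circ)$ with $(A,+)$ abelian, $(A,\circ)$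 a group, $a\circ(b+c)=a\circ b-a+a\circ c$; $\lambda_a(b)=-a+a\circ b$. For an element $y$ of a transitive cycle base of $A$ (a single orbit of the action $\lambda$ of $(A,\circ)$ on $A$ generating $(A,+)$), $r_y(a,b)=(\sigma_a(b),\sigma^{-1}_{\sigma_a(b)}(a))$ with $\sigma_a(b)=\lambda_a(y)\circ b$. The image of $x$ in any quotient of $F_n$ lies in a transitive cycle base. A solution is a pair $(X,r)$ with $X$ a nonempty set and $r:X^2\to X^2$ a bijection, $r(x,y)=(\sigma_x(y),\tau_y(x))$, satisfying the braid equation $(r\times \mathrm{id})(\mathrm{id}\times r)(r\times \mathrm{id})=(\mathrm{id}\times r)(r\times \mathrm{id})(\mathrm{id}\times r)$ with all $\sigma_x,\tau_x$ bijective. It is involutive if $r^2=\mathrm{id}$; indecomposable if the group generated by all $\sigma_x,\tau_x$ is transitive on $X$; its permutation group is $\langle(\sigma_x,\tau_x^{-1})\mid x\in X\rangle$. Isomorphisms are bijections $f$ with $(f\times f)r=s(f\times f)$. $\mathrm{Ret}(X,r)$ is the induced solution on $X/{\sim}$, where $x\sim y$ iff $\sigma_x=\sigma_y$ and $\tau_x=\tau_y$. $\mathbf{AbSol}(m_1,\dots,m_n)$ consists of the finite indecomposable involutive solutions $(X,r)$ with abelian permutation group such that $|\mathrm{Ret}^{i-1}(X,r)|/|\mathrm{Ret}^{i}(X,r)|=m_i$ for $1\le i\le n$ and $|\mathrm{Ret}^n(X,r)|=1$. *)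

(* Defs.v *)
From HB Require Import structures.
From mathcomp Require Import all_boot all_order all_algebra finmap ring.
From mathcomp Require Import boolp classical_sets functions cardinality.

Set Implicit Arguments.
Unset Strict Implicit.
Unset Printing Implicit Defensive.

Import GRing.Theory.
Import Quotient.
Local Open Scope classical_set_scope.
Local Open Scope ring_scope.

Definition gen_zmod (V : zmodType) (A : set V) : set V :=
  smallest (fun H : set V => zmod_closed (fun v => v \in H)) A.

Definition gen_group (G : groupType) (A : set G) : set G :=
  smallest (fun H : set G => group_closed (fun g => g \in H)) A.

Lemma gen_zmod_closed (V : zmodType) (A : set V) :
  zmod_closed (fun v => v \in gen_zmod A).
Proof.
split=> [|u v]; first by apply/mem_set => H [[H0 _] _]; exact: set_mem H0.
move=> /set_mem uA /set_mem vA; apply/mem_set => H HP; have [[_ HB] _] := HP.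
by apply/set_mem/HB; apply/mem_set; [exact: uA | exact: vA].
Qed.

(* [x * y] is the composition [x \o y]. *)
Record sym (X : Type) := Sym { sym_fun :> X -> X; sym_bij : bijective sym_fun }.

HB.instance Definition _ (X : Type) := gen_eqMixin (sym X).
HB.instance Definition _ (X : Type) := gen_choiceMixin (sym X).

Section SymGroup.
Variable X : Type.
Implicit Types s t : sym X.

Lemma symP s t : s =1 t -> s = t.
Proof.
case: s t => [f fb] [g gb] /= /funext fg; case: g / fg gb => gb.
by rewrite (Prop_irrelevance fb gb).
Qed.

Lemma sym_inv_exists s : exists t, cancel s t /\ cancel t s.
Proof. by case: (sym_bij s) => g sg gs; exists (Sym (Bijective gs sg)). Qed.

Definition sym_one : sym X := Sym (@Bijective X X id id (fun=> erefl) (fun=> erefl)).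
Definition sym_mul s t : sym X := Sym (bij_comp (sym_bij s) (sym_bij t)).
Definition sym_inv s : sym X := sval (cid (sym_inv_exists s)).

Lemma sym_mulA : associative sym_mul. Proof. by move=> *; apply: symP. Qed.
Lemma sym_mul1 : left_id sym_one sym_mul. Proof. by move=> *; apply: symP. Qed.
Lemma sym_mulr1 : right_id sym_one sym_mul. Proof. by move=> *; apply: symP. Qed.
Lemma sym_mulV : left_inverse sym_one sym_inv sym_mul.
Proof.
move=> s; apply: symP => x /=; rewrite /sym_inv; case: cid => t /= [st _].
exact: st.
Qed.
Lemma sym_mulrV : right_inverse sym_one sym_inv sym_mul.
Proof.
move=> s; apply: symP => x /=; rewrite /sym_inv; case: cid => t /= [_ ts].
exact: ts.
Qed.

HB.instance Definition _ := isGroup.Build (sym X)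
  sym_mulA sym_mul1 sym_mulr1 sym_mulV sym_mulrV.
End SymGroup.

(* A set with a map [X^2 -> X^2]; [is_solution] says when it is a solution. *)
Record ybmap := YBMap { ybset :> choiceType; yb : ybset * ybset -> ybset * ybset }.

Section Solutions.
Variable S : ybmap.
Local Notation r := (@yb S).

Definition sigma (x y : S) : S := (r (x, y)).1.
Definition tau (y x : S) : S := (r (x, y)).2.

Definition r12 (u : S * S * S) : S * S * S := (r u.1, u.2).
Definition r23 (u : S * S * S) : S * S * S :=
  let v := r (u.1.2, u.2) in (u.1.1, v.1, v.2).

Definition is_solution : Prop :=
  [/\ inhabited S, bijective r,
      r12 \o r23 \o r12 =1 r23 \o r12 \o r23,
      forall x, bijective (sigma x) & forall x, bijective (tau x)].

Definition yb_involutive : Prop := r \o r =1 id.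

Definition indecomposable : Prop :=
  let G := gen_group [set s : sym S |
    exists x, (s : S -> S) = sigma x \/ (s : S -> S) = tau x] in
  forall x y : S, exists2 g : sym S, G g & g x = y.

Definition permutation_group : set (sym S * sym S)%type :=
  gen_group [set g : sym S * sym S |
    exists x, (g.1 : S -> S) = sigma x /\ ((g.2)^-1%g : S -> S) = tau x].

Definition abelian_permutation_group : Prop :=
  forall g h, permutation_group g -> permutation_group h -> commute g h.

Definition ret_rel : rel S :=
  fun x y => `[< sigma x = sigma y /\ tau x = tau y >].

Lemma ret_rel_equiv : equiv_class_of ret_rel.
Proof.
split=> [x|x y|y x z]; rewrite /ret_rel.
- exact/asboolP.
- by apply: asbool_equiv_eq; split=> -[-> ->].
- by move=> /asboolP[-> ->].
Qed.

Canonical ret_equiv_rel := EquivRelPack ret_rel_equiv.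
Canonical ret_encModRel := defaultEncModRel ret_rel.

Definition ret_set := {eq_quot ret_rel}%qT.
HB.instance Definition _ := Choice.on ret_set.
HB.instance Definition _ : EqQuotient S ret_rel ret_set := EqQuotient.on ret_set.

(* The map is computed on representatives so as to be total; [RetE] shows that
   for a solution it is the map induced on the quotient. *)
Definition Ret : ybmap :=
  @YBMap ret_set (fun ab =>
    let cd := r (repr ab.1, repr ab.2) in
    (\pi_ret_set cd.1, \pi_ret_set cd.2)%qT).

Lemma ret_piP (x y : S) :
  \pi_ret_set%qT x = \pi_ret_set%qT y <-> sigma x = sigma y /\ tau x = tau y.
Proof.
split=> [/eqmodP/asboolP//|xy].
by apply/eqmodP; exact/asboolP.
Qed.
End Solutions.

Lemma RetE (S : ybmap) (x y : S) : is_solution S ->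
  @yb (Ret S) (\pi_(ret_set S)%qT x, \pi_(ret_set S)%qT y) =
  (\pi_(ret_set S)%qT (sigma x y), \pi_(ret_set S)%qT (tau y x)).
Proof.
case=> _ _ braid sb tb.
have e1 (a b c : S) : sigma (sigma a b) (sigma (tau b a) c) = sigma a (sigma b c).
  by have := congr1 (fun u : S * S * S => u.1.1) (braid (a, b, c)).
have e3 (a b c : S) : tau c (tau b a) = tau (tau c b) (tau (sigma b c) a).
  by have := congr1 (fun u : S * S * S => u.2) (braid (a, b, c)).
have sur (f : S -> S) (fb : bijective f) (z : S) : exists w, f w = z.
  by case: fb => g _ fg; exists (g z).
have reprE z : sigma (repr (\pi_(ret_set S)%qT z)) = sigma z /\
               tau (repr (\pi_(ret_set S)%qT z)) = tau z.
  by apply/ret_piP; rewrite reprK.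
have [sx tx] := reprE x; have [sy ty] := reprE y.
rewrite /yb /=; set x' := repr _ in sx tx *; set y' := repr _ in sy ty *.
rewrite -/(sigma x' y') -/(tau y' x') sx ty.
congr pair; apply/ret_piP; split; apply/funext => z.
- have [w <-] := sur _ (sb (tau y x)) z.
  by rewrite [RHS]e1 -sy -ty e1.
- apply: (bij_inj (tb (tau y x))).
  by rewrite -[RHS]e3 -ty -e3.
- apply: (bij_inj (sb (sigma x y))).
  by rewrite [RHS]e1 -sx e1.
- have [w <-] := sur _ (tb (sigma x y)) z.
  by rewrite -[RHS]e3 -tx -sx -e3.
Qed.

Definition yb_iso (S T : ybmap) : Prop :=
  exists f : S -> T, bijective f /\
    forall x y, (f (yb (x, y)).1, f (yb (x, y)).2) = yb (f x, f y).

Definition yb_card (S : ybmap) : nat := #|` fset_set [set: S]|%fset.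

(* Entry [m i], [0 <= i < n], is the number written m_(i+1). *)
Definition AbSol (n : nat) (m : 'I_n -> nat) (S : ybmap) : Prop :=
  [/\ is_solution S /\ finite_set [set: S], indecomposable S, yb_involutive S,
      abelian_permutation_group S &
      (forall i : 'I_n,
        (yb_card (iter i Ret S))%:R / (yb_card (iter i.+1 Ret S))%:R
          = (m i)%:R :> rat) /\
      yb_card (iter n Ret S) = 1%N].

(* The additive group is the [zmodType] structure, the circle operation is the
   multiplication [( _ * _)%g] of the [groupType] structure. *)
HB.mixin Record isBrace A of GRing.Zmodule A & Group A := {
  brace_mulDr : forall a b c : A, (a * (b + c))%g = (a * b)%g - a + (a * c)%g
}.

#[short(type="braceType")]
HB.structure Definition Brace :=
  {A of isBrace A & GRing.Zmodule A & Group A}.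

Definition lam (A : braceType) (a b : A) : A := - a + (a * b)%g.

HB.mixin Record isBraceIdeal (A : braceType) (I : A -> bool) := {
  lam_ideal : forall a i, i \in I -> lam a i \in I;
  conj_ideal : forall a i, i \in I -> (a * i * a^-1)%g \in I
}.

#[short(type="braceIdeal")]
HB.structure Definition BraceIdeal (A : braceType) :=
  {I of GRing.ZmodClosed A I & isBraceIdeal A I}.

Section BraceTheory.
Variable A : braceType.
Implicit Types a b c : A.

Lemma brace10 : 1%g = 0 :> A.
Proof.
have := brace_mulDr (1%g : A) 0 0.
by rewrite addr0 !mul1g addr0 sub0r => /eqP; rewrite eq_sym oppr_eq0 => /eqP.
Qed.

Lemma mulg_lam a b : (a * b)%g = a + lam a b.
Proof. by rewrite /lam addrA addrN add0r. Qed.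

Lemma lamB a b c : lam a (b - c) = lam a b - lam a c.
Proof.
apply/eqP; rewrite eq_sym subr_eq; apply/eqP.
by rewrite {1 2}/lam -addrA (addrA _ (- a)) -brace_mulDr addrNK.
Qed.

Lemma lamM a b c : lam (a * b)%g c = lam a (lam b c).
Proof.
have -> : lam b c = (b * c)%g - b by rewrite addrC.
by rewrite lamB /lam opprD opprK -mulgA [RHS]addrACA addNr add0r addrC.
Qed.

Lemma lam1 b : lam 1%g b = b.
Proof. by rewrite /lam mul1g brace10 oppr0 add0r. Qed.
End BraceTheory.

Section BraceQuotient.
Variables (A : braceType) (I : braceIdeal A).
Local Notation Q := (quot I).
Local Notation pi := (\pi_Q%qT).

Lemma quot_pi_eq (a b : A) : pi a = pi b <-> a - b \in I.
Proof.
by rewrite Quotient.idealrBE; split=> [/eqP|/eqP].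
Qed.

Lemma quot_mul_compat (a a' b b' : A) :
  a - a' \in I -> b - b' \in I -> (a * b)%g - (a' * b')%g \in I.
Proof.
move=> aI bI; rewrite -(subrK (a * b')%g (a * b)%g) -addrA rpredD//.
  have -> : (a * b)%g - (a * b')%g = lam a (b - b').
    by rewrite lamB !mulg_lam opprD addrACA subrr add0r.
  exact: lam_ideal.
pose j := lam a'^-1%g (a - a').
have -> : a = (a' * j)%g.
  by rewrite mulg_lam -lamM mulgV lam1 addrC subrK.
have -> : (a' * j * b' = (a' * b') * (b'^-1 * j * b'^-1^-1))%g.
  by rewrite invgK -!mulgA mulVKg.
rewrite [X in X - _]mulg_lam addrAC subrr add0r.
by apply/lam_ideal/conj_ideal/lam_ideal.
Qed.

Definition quot_one : Q := pi 1%g.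
Definition quot_mul (u v : Q) : Q := pi (repr u * repr v)%g.
Definition quot_inv (u : Q) : Q := pi (repr u)^-1%g.

Lemma pi_quot_mul (a b : A) : quot_mul (pi a) (pi b) = pi (a * b)%g.
Proof.
by apply/quot_pi_eq/quot_mul_compat; apply/quot_pi_eq; rewrite reprK.
Qed.

Lemma quot_mulA : associative quot_mul.
Proof.
move=> u v w; elim/quotP: u => a _; elim/quotP: v => b _.
elim/quotP: w => c _.
by rewrite (pi_quot_mul b c) (pi_quot_mul a b) !pi_quot_mul mulgA.
Qed.

Lemma quot_mul1 : left_id quot_one quot_mul.
Proof. by move=> u; elim/quotP: u => a _; rewrite (pi_quot_mul 1%g a) mul1g. Qed.

Lemma quot_mulr1 : right_id quot_one quot_mul.
Proof. by move=> u; elim/quotP: u => a _; rewrite (pi_quot_mul a 1%g) mulg1. Qed.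

Lemma quot_mulV : left_inverse quot_one quot_inv quot_mul.
Proof. by move=> u; rewrite -{2}[u]reprK (pi_quot_mul (repr u)^-1%g (repr u)) mulVg. Qed.

Lemma quot_mulrV : right_inverse quot_one quot_inv quot_mul.
Proof. by move=> u; rewrite -{1}[u]reprK (pi_quot_mul (repr u) (repr u)^-1%g) mulgV. Qed.

HB.instance Definition _ := isGroup.Build Q
  quot_mulA quot_mul1 quot_mulr1 quot_mulV quot_mulrV.

Lemma pi_mulg (a b : A) : (pi a * pi b)%g = pi (a * b)%g.
Proof. exact: pi_quot_mul. Qed.

Lemma quot_brace (u v w : Q) : (u * (v + w))%g = (u * v)%g - u + (u * w)%g.
Proof.
elim/quotP: u => a _; elim/quotP: v => b _; elim/quotP: w => c _.
rewrite -[pi b + pi c]raddfD (pi_mulg a (b + c)) (pi_mulg a b) (pi_mulg a c).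
by rewrite brace_mulDr raddfD raddfB.
Qed.

HB.instance Definition _ := isBrace.Build Q quot_brace.
End BraceQuotient.

Definition transitive_cycle_base (A : braceType) (B : set A) : Prop :=
  (exists y : A, B = [set lam a y | a in [set: A]]) /\ gen_zmod B = [set: A].

(* The map [r_y]; the formula makes sense for every [y : A]. *)
Section BraceSolution.
Variables (A : braceType) (y : A).

Definition brace_sigma (a b : A) : A := (lam a y * b)%g.
Definition brace_sigma_inv (a b : A) : A := ((lam a y)^-1 * b)%g.

Lemma brace_sigmaK (a : A) : cancel (brace_sigma a) (brace_sigma_inv a).
Proof. exact: mulKg. Qed.

Lemma brace_sigma_invK (a : A) : cancel (brace_sigma_inv a) (brace_sigma a).
Proof. exact: mulVKg. Qed.

Definition brace_yb : ybmap :=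
  @YBMap A (fun ab =>
    let s := brace_sigma ab.1 ab.2 in (s, brace_sigma_inv s ab.1)).
End BraceSolution.

Section Fn.
Variable n : nat.
Local Notation Zx := {poly %/ ('X^(n.+1) : {poly int})}.

(* The non-unital subring of [Z[x]/(x^(n+1))] generated by [x]. *)
Definition Fn_pred : {pred Zx} := fun q => q \in
  smallest (fun H : set Zx => zmod_closed (fun q => q \in H) /\
                              GRing.mulr_2closed (fun q => q \in H)) [set 'qX].

Record Fn := MkFn { Fn_val :> Zx; _ : Fn_pred Fn_val }.
HB.instance Definition _ := [isSub for Fn_val].
HB.instance Definition _ := [Choice of Fn by <:].

Lemma Fn_zmod_closed : zmod_closed Fn_pred.
Proof.
split=> [|u v]; first by apply/mem_set => H [[[H0 _] _] _]; exact: set_mem H0.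
move=> /set_mem uA /set_mem vA; apply/mem_set => H HP; have [[[_ HB] _] _] := HP.
by apply/set_mem/HB; apply/mem_set; [exact: uA | exact: vA].
Qed.

Lemma Fn_mulr_closed : GRing.mulr_2closed Fn_pred.
Proof.
move=> u v /set_mem uA /set_mem vA; apply/mem_set => H HP; have [[_ HM] _] := HP.
by apply/set_mem/HM; apply/mem_set; [exact: uA | exact: vA].
Qed.

Lemma Fn_qX : 'qX \in Fn_pred.
Proof. by apply/mem_set => H [_]; exact. Qed.

HB.instance Definition _ := GRing.isZmodClosed.Build Zx Fn_pred Fn_zmod_closed.
HB.instance Definition _ := [SubChoice_isSubZmodule of Fn by <:].

Definition Fn_mul (a b : Fn) : Fn :=
  MkFn (Fn_mulr_closed (valP a) (valP b)).

Lemma qX_nilp : 'qX ^+ n.+1 = 0 :> Zx.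
Proof.
rewrite -[LHS](rmorphXn (in_qpoly _)) /=.
apply/val_inj => /=; rewrite mk_monic_Xn /=.
exact/Pdiv.RingMonic.rmodpp/monicXn.
Qed.

Lemma Fn_nilp (q : Fn) : (q : Zx) ^+ n.+1 = 0.
Proof.
suff [f ->] : exists f, (q : Zx) = 'qX * f by rewrite exprMn qX_nilp mul0r.
have /set_mem/(_ [set g | exists f, g = 'qX * f]) := valP q.
apply; split=> [|_ ->]; last by exists 1; rewrite mulr1.
split; first split; first by apply/mem_set; exists 0; rewrite mulr0.
- move=> u v /set_mem[f ->] /set_mem[g ->]; apply/mem_set.
  by exists (f - g); rewrite mulrBr.
- move=> u v /set_mem[f ->] /set_mem[g ->]; apply/mem_set.
  by exists (f * ('qX * g)); rewrite -mulrA.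
Qed.

Lemma Fn_exp_closed (u : Zx) k : u \in Fn_pred -> u ^+ k.+1 \in Fn_pred.
Proof.
move=> uF; elim: k => [|k IHk]; first by rewrite expr1.
by rewrite (exprS u k.+1); exact: Fn_mulr_closed.
Qed.

Lemma Fn_inv_subproof (q : Fn) :
  Fn_pred (\sum_(1 <= k < n.+1) (- (q : Zx)) ^+ k).
Proof.
rewrite -[Fn_pred _]/(_ \in Fn_pred) big_nat rpred_sum // => -[//|k] _.
by apply: Fn_exp_closed; rewrite rpredN; exact: valP.
Qed.

Definition Fn_circ (a b : Fn) : Fn := a + Fn_mul a b + b.
Definition Fn_inv (a : Fn) : Fn := MkFn (Fn_inv_subproof a).

Lemma Fn_circE (a b : Fn) : 1 + (Fn_circ a b : Zx) = (1 + (a : Zx)) * (1 + (b : Zx)).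
Proof. by rewrite mulrDl mul1r mulrDr mulr1 /=; ring. Qed.

Lemma Fn_invE (a : Fn) : (1 + (a : Zx)) * (1 + (Fn_inv a : Zx)) = 1.
Proof.
have -> : 1 + (Fn_inv a : Zx) = \sum_(k < n.+1) (- (a : Zx)) ^+ k.
  by rewrite big_ord_recl expr0 /= big_add1 big_mkord.
have := subrX1 (- (a : Zx)) n.+1.
rewrite exprNn Fn_nilp mulr0 => /(congr1 -%R).
by rewrite sub0r opprK -mulNr opprD !opprK addrC => <-.
Qed.

Lemma Fn_circ_inj (a b : Fn) : 1 + (a : Zx) = 1 + (b : Zx) -> a = b.
Proof. by move=> /addrI /val_inj. Qed.

Lemma Fn_circA : associative Fn_circ.
Proof. by move=> a b c; apply: Fn_circ_inj; rewrite !Fn_circE mulrA. Qed.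

Lemma Fn_circC : commutative Fn_circ.
Proof. by move=> a b; apply: Fn_circ_inj; rewrite !Fn_circE mulrC. Qed.

Lemma Fn_circ0 : left_id 0 Fn_circ.
Proof. by move=> a; apply: Fn_circ_inj; rewrite Fn_circE addr0 mul1r. Qed.

Lemma Fn_circr0 : right_id 0 Fn_circ.
Proof. by move=> a; rewrite Fn_circC Fn_circ0. Qed.

Lemma Fn_circrV : right_inverse 0 Fn_inv Fn_circ.
Proof. by move=> a; apply: Fn_circ_inj; rewrite Fn_circE Fn_invE addr0. Qed.

Lemma Fn_circV : left_inverse 0 Fn_inv Fn_circ.
Proof. by move=> a; rewrite Fn_circC Fn_circrV. Qed.

HB.instance Definition _ := isGroup.Build Fn
  Fn_circA Fn_circ0 Fn_circr0 Fn_circV Fn_circrV.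

Lemma Fn_circE' (a b : Fn) : (a * b)%g = a + Fn_mul a b + b.
Proof. by []. Qed.

Lemma Fn_brace (a b c : Fn) : (a * (b + c))%g = (a * b)%g - a + (a * c)%g.
Proof. by apply/val_inj; rewrite !Fn_circE' /=; ring. Qed.

HB.instance Definition _ := isBrace.Build Fn Fn_brace.

Definition Fn_x : Fn := MkFn Fn_qX.

Lemma Fn_row_subproof (v : 'rV[int]_n) :
  Fn_pred (\sum_(j < n) v ord0 j *: 'qX ^+ j.+1).
Proof.
rewrite -[Fn_pred _]/(_ \in Fn_pred) rpred_sum // => j _.
rewrite -[v _ _]intz scaler_int rpredMz //; apply: Fn_exp_closed; exact: Fn_qX.
Qed.

(* [(m_1, ..., m_n)] is sent to [m_1 x + ... + m_n x^n]. *)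
Definition Fn_row (v : 'rV[int]_n) : Fn := MkFn (Fn_row_subproof v).
End Fn.

Definition shift_row (n : nat) (v : 'rV[int]_n) : 'rV[int]_n :=
  \row_j (if val j == 0%N then 0 else v ord0 (ord_pred j)).

(* Rows and columns are numbered from 0. *)
Record calM (p n : nat) (d : 'I_n -> nat) := CalM {
  calM_mx :> 'M[int]_n;
  calM_upper : forall i j : 'I_n, (j < i)%N -> calM_mx i j = 0;
  calM_ge0 : forall i j : 'I_n, 0 <= calM_mx i j;
  calM_diag_gt : forall i j : 'I_n, i != j -> calM_mx i j < calM_mx j j;
  calM_shift : forall k : 'I_n,
    gen_zmod [set v | exists2 l : 'I_n, (k < l)%N & v = row l calM_mx]
      (shift_row (row k calM_mx));
  calM_diag : forall i : 'I_n, calM_mx i i = (p ^ d i)%:Z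
}.

Section IdealOfMatrix.
Variables (p n : nat) (d : 'I_n -> nat) (M : calM p d).

Definition I_M : {pred Fn n} := fun f =>
  f \in gen_zmod [set Fn_row (row k M) | k in [set: 'I_n]].

Lemma I_M_zmod_closed : zmod_closed I_M.
Proof. exact: gen_zmod_closed. Qed.
HB.instance Definition _ := GRing.isZmodClosed.Build (Fn n) I_M I_M_zmod_closed.

Lemma Fn_rowB : zmod_morphism (@Fn_row n).
Proof.
move=> u v; apply: val_inj; rewrite /= -sumrB; apply: eq_bigr => j _.
by rewrite !mxE scalerBl.
Qed.

Lemma Fn_mul_x_row (v : 'rV[int]_n) :
  Fn_mul (Fn_x n) (Fn_row v) = Fn_row (shift_row v).
Proof.
apply: val_inj => /=; rewrite mulr_sumr.
case: n v => [|m] v; first by rewrite !big_ord0.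
rewrite big_ord_recr [RHS]big_ord_recl /= -scalerAr -exprS qX_nilp scaler0.
rewrite mxE /= scale0r addr0 add0r; apply: eq_bigr => i _.
rewrite mxE /= -scalerAr -exprS; congr (v _ _ *: _).
by apply: val_inj; rewrite /= modnDr modn_small // add0n ltnS ltnW.
Qed.

Lemma I_M_mul_x (f : Fn n) : f \in I_M -> Fn_mul (Fn_x n) f \in I_M.
Proof.
have [I0 IB] := I_M_zmod_closed.
move=> /set_mem/(_ [set f | Fn_mul (Fn_x n) f \in I_M]); apply; split=> [|_ [k _ <-]].
  split=> [|u v /set_mem uP /set_mem vP]; apply/mem_set => /=.
    by have -> : Fn_mul (Fn_x n) 0 = 0 by apply: val_inj; rewrite /= mulr0.
  have -> : Fn_mul (Fn_x n) (u - v) = Fn_mul (Fn_x n) u - Fn_mul (Fn_x n) v.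
    by apply: val_inj; rewrite /= mulrBr.
  exact: IB.
rewrite /= Fn_mul_x_row.
have /(_ [set v | Fn_row v \in I_M]) := @calM_shift _ _ _ M k; apply; split.
  split=> [|u v /set_mem uP /set_mem vP]; apply/mem_set => /=.
    by have -> : Fn_row (0 : 'rV[int]_n) = 0
      by rewrite -[X in Fn_row X](subrr 0) Fn_rowB subrr.
  by rewrite Fn_rowB; exact: IB.
by move=> _ [l _ ->] /=; apply/mem_set; apply: sub_gen_smallest; exists l.
Qed.

Lemma I_M_mul (a f : Fn n) : f \in I_M -> Fn_mul a f \in I_M.
Proof.
have [I0 IB] := I_M_zmod_closed.
move=> fI; have /set_mem/(_ [set q | forall f : Fn n, f \in I_M ->
  exists2 g, g \in I_M & Fn_val g = q * Fn_val f]) H := valP a.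
have [|g gI gE] := H _ f fI.
  split=> [|_ -> g gI]; last by exists (Fn_mul (Fn_x n) g) => //; exact: I_M_mul_x.
  split; first split.
  - by apply/mem_set => g _; exists 0 => //; rewrite mul0r.
  - move=> u v /set_mem uP /set_mem vP; apply/mem_set => g gI.
    have [gu guI guE] := uP _ gI; have [gv gvI gvE] := vP _ gI.
    by exists (gu - gv); [exact: IB|rewrite /= guE gvE mulrBl].
  - move=> u v /set_mem uP /set_mem vP; apply/mem_set => g gI.
    have [gv gvI gvE] := vP _ gI; have [gu guI guE] := uP _ gvI.
    by exists gu => //; rewrite guE gvE mulrA.
by have -> : Fn_mul a f = g by apply: val_inj.
Qed.

Lemma I_M_lam (a f : Fn n) : f \in I_M -> lam a f \in I_M.
Proof.
move=> fI; have -> : lam a f = Fn_mul a f + f.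
  by rewrite /lam -[(a * f)%g]/(a + Fn_mul a f + f) -addrA addKr.
by rewrite rpredD //; exact: I_M_mul.
Qed.

Lemma I_M_conj (a f : Fn n) : f \in I_M -> (a * f * a^-1)%g \in I_M.
Proof.
by move=> fI; have -> : (a * f)%g = (f * a)%g by [exact: Fn_circC]; rewrite mulgK.
Qed.

HB.instance Definition _ := isBraceIdeal.Build (Fn n) I_M I_M_lam I_M_conj.

Definition Fn_mod : braceType := quot (I_M : braceIdeal (Fn n)).
Definition Fn_mod_x : Fn_mod := \pi_(quot (I_M : braceIdeal (Fn n)))%qT (Fn_x n).

Local Notation piM := (\pi_(quot (I_M : braceIdeal (Fn n)))%qT).

Lemma Fn_mod_x_cycle_base :
  exists2 B : set Fn_mod, transitive_cycle_base B & B Fn_mod_x.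
Proof.
exists [set lam a Fn_mod_x | a in [set: Fn_mod]]; last first.
  by exists 1%g => //; exact: lam1.
split; first by exists Fn_mod_x.
apply/seteqP; split=> // q _; elim/quotP: q => f _.
move=> H [[H0 HB] HG].
have HN u : u \in H -> - u \in H by move=> uH; rewrite -[- u]add0r; exact: HB.
have HD u v : u \in H -> v \in H -> u + v \in H.
  by move=> uH vH; rewrite -[v]opprK; apply: HB => //; exact: HN.
have Hlam (a : Fn n) :
    piM (lam a (Fn_x n)) \in H.
  apply/mem_set/HG; exists (piM a) => //.
  by rewrite /lam [RHS]raddfD /= raddfN -(pi_mulg _ a (Fn_x n)).
have HX : Fn_mod_x \in H by rewrite /Fn_mod_x -[X in piM X](lam1 (Fn_x n)).
have HM (a : Fn n) :
    piM (Fn_mul a (Fn_x n)) \in H.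
  have -> : Fn_mul a (Fn_x n) = lam a (Fn_x n) - Fn_x n.
    rewrite /lam -[(a * Fn_x n)%g]/(a + Fn_mul a (Fn_x n) + Fn_x n).
    by rewrite -(addrA a) addKr addrK.
  by rewrite raddfB; apply: HB; [exact: Hlam | exact: HX].
have valMz (u : Fn n) (c : int) : Fn_val (u *~ c) = Fn_val u *~ c.
  exact: (raddfMz (val : Fn n -> _)).
pose g (c : int) (a : Fn n) := Fn_x n *~ c + Fn_mul a (Fn_x n).
have gE c a : Fn_val (g c a) = 'qX *~ c + Fn_val a * 'qX.
  by rewrite /g /= valMz.
have K := set_mem (valP f) [set q | exists c a, q = Fn_val (g c a)].
have [|c [a fE]] := K.
  split; last by move=> _ ->; exists 1, 0; rewrite gE mul0r addr0.
  split; first split.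
  - by apply/mem_set; exists 0, 0; rewrite gE mul0r addr0.
  - move=> _ _ /set_mem[c [a ->]] /set_mem[c' [a' ->]]; apply/mem_set.
    by exists (c - c'), (a - a'); rewrite !gE mulrzBr mulrBl opprD addrACA.
  - move=> _ _ /set_mem[c [a ->]] /set_mem[c' [a' ->]]; apply/mem_set.
    exists 0, (g c a *~ c' + Fn_mul (g c a) a').
    rewrite !gE /= valMz gE mulr0z add0r [RHS]mulrDl mulrDr; congr (_ + _).
      by rewrite mulrzAr mulrzAl.
    by rewrite mulrA valMz.
have HXn k : Fn_mod_x *+ k \in H.
  by elim: k => [|k IHk]; rewrite ?mulr0n// mulrS; exact: HD.
have -> : f = g c a by exact: val_inj.
rewrite /g raddfD /= raddfMz; apply/set_mem; apply: HD; last exact: HM.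
by case: c {fE} => k; [exact: HXn | exact/HN/HXn].
Qed.
End IdealOfMatrix.

(* Main.v *)
Require Import Defs.
From HB Require Import structures.
From mathcomp Require Import all_boot all_order all_algebra finmap zify.
From mathcomp Require Import boolp classical_sets functions cardinality.

(* A solution in AbSol is, up to the choice of a base point, an abelian group
   acting on itself with sigma_a the translation by some f a. The braid equation
   says that the maps g |-> g f(g^-1 a) commute; they again form a regular family
   of bijections, and the abelian group they generate is an addition turning the
   set into a brace whose circle operation is commutative, that is, into a
   nilpotent commutative ring, generated by y = f 1. The solution is then r_y,
   and its i-th retract is the quotient by the annihilator of y^i. Hence y^n
   annihilates the ring, which is F_n / I for an ideal I, and the
   triangular (Hermite) basis of the lattice I of Z^n is the matrix M. Its
   diagonal is read off the cardinalities of the retracts, since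
   |Ret^i| = |x^i F_n / (x^i F_n meet I)| is the product of the last n - i
   diagonal entries; the same count gives the direct implication. *)

Set Implicit Arguments.
Unset Strict Implicit.
Unset Printing Implicit Defensive.

Import Order.TTheory GRing.Theory Num.Theory.
Local Open Scope classical_set_scope.
Local Open Scope ring_scope.

(** * Generated subgroups *)

Lemma gen_zmod0 (V : zmodType) (E : set V) : gen_zmod E 0.
Proof. by have [H _] := gen_zmod_closed E; exact: set_mem H. Qed.

Lemma gen_zmodB (V : zmodType) (E : set V) u v :
  gen_zmod E u -> gen_zmod E v -> gen_zmod E (u - v).
Proof.
have [_ H] := gen_zmod_closed E => Eu Ev.
by apply/set_mem/H; exact: mem_set.
Qed.

Lemma gen_zmodD (V : zmodType) (E : set V) u v :
  gen_zmod E u -> gen_zmod E v -> gen_zmod E (u + v).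
Proof.
move=> Eu Ev; rewrite -[v]opprK -[- v]sub0r.
by do 2 apply: gen_zmodB => //; exact: gen_zmod0.
Qed.

Lemma gen_zmod_sub (V : zmodType) (E H : set V) : H 0 ->
  (forall u v, H u -> H v -> H (u - v)) -> E `<=` H -> gen_zmod E `<=` H.
Proof.
move=> H0 HB; apply: smallest_sub; split=> [|u v /set_mem Hu /set_mem Hv].
  exact: mem_set.
by apply/mem_set/HB.
Qed.

(** * Braces with commutative circle operation *)

Section CommutativeBrace.
Variables (A : braceType) (circC : forall a b : A, (a * b)%g = (b * a)%g).
Implicit Types a b c s t y : A.

Lemma lamr0 a : lam a 0 = 0.
Proof. by have := lamB a 0 0; rewrite !subrr. Qed.

Lemma lam_inj a : injective (lam a).
Proof. by move=> b c /(congr1 (lam a^-1%g)); rewrite -!lamM mulVg !lam1. Qed.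

Lemma lamC a b c : lam a (lam b c) = lam b (lam a c).
Proof. by rewrite -!lamM circC. Qed.

(* The product of the ring structure carried by a brace with commutative
   circle operation. *)
Definition bmul a b : A := lam a b - b.

Lemma bmulE a b : bmul a b = (a * b)%g - a - b.
Proof. by rewrite /bmul /lam [- a + _]addrC. Qed.

Lemma bmulC a b : bmul a b = bmul b a.
Proof. by rewrite !bmulE circC addrAC. Qed.

Lemma lamE a b : lam a b = b + bmul a b.
Proof. by rewrite /bmul addrC subrK. Qed.

Lemma lam_bmul a b : lam a b = b + bmul b a.
Proof. by rewrite lamE bmulC. Qed.

Lemma bmulBr a : {morph bmul a : b c / b - c}.
Proof. by move=> b c; rewrite /bmul lamB !opprB [LHS]addrACA [RHS]addrACA (addrC (- b)). Qed.

Lemma bmulr0 a : bmul a 0 = 0.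
Proof. by rewrite /bmul lamr0 subrr. Qed.

Lemma bmul_lam a b c : bmul a (lam b c) = lam b (bmul a c).
Proof. by rewrite /bmul lamB lamC. Qed.

(** Associativity in disguise, given [bmulC]. In this form it follows at once from the fact that the
    maps [lam a] commute. *)
Lemma bmulA a b c : bmul a (bmul b c) = bmul b (bmul a c).
Proof. by rewrite [bmul b c]/bmul bmulBr bmul_lam. Qed.

Section Iter.
Variable y : A.
Local Notation D := (bmul y).

Lemma iter_bmulB i : {morph iter i D : a b / a - b}.
Proof. by elim: i => //= i IHi a b /=; rewrite IHi bmulBr. Qed.

Lemma iter_bmul0 i : iter i D 0 = 0.
Proof. by elim: i => //= i ->; rewrite bmulr0. Qed.

Lemma iter_bmulN i : {morph iter i D : a / - a}.
Proof. by move=> a; rewrite -sub0r iter_bmulB iter_bmul0 sub0r. Qed.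

Lemma iter_bmulD i : {morph iter i D : a b / a + b}.
Proof. by move=> a b; rewrite -{1}[b]opprK iter_bmulB iter_bmulN opprK. Qed.

Lemma iter_bmul_lam i a b : iter i D (lam a b) = lam a (iter i D b).
Proof. by elim: i => //= i ->; rewrite bmul_lam. Qed.

Lemma iter_lam_eq0 i a b : iter i D (lam a b) = 0 -> iter i D b = 0.
Proof. by rewrite iter_bmul_lam => H; apply: (@lam_inj a); rewrite lamr0. Qed.

Lemma sigma_lam a b : brace_sigma y a b = b + lam b (lam a y).
Proof. by rewrite /brace_sigma circC mulg_lam. Qed.

(** The first argument enters the value only through y (a - a'), up to the automorphism [lam b].
    This extra factor y is why each retraction raises the power of y by one. *)
Lemma sigmaBl a a' b :
  brace_sigma y a b - brace_sigma y a' b = lam b (D (a - a')).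
Proof.
rewrite !sigma_lam opprD addrACA subrr add0r -lamB.
by rewrite !(lam_bmul _ y) opprD addrACA subrr add0r -bmulBr.
Qed.

Lemma sigmaBr a b b' :
  brace_sigma y a b - brace_sigma y a b' = lam (lam a y) (b - b').
Proof. by rewrite /brace_sigma !mulg_lam opprD addrACA subrr add0r -lamB. Qed.

Definition brace_tau b a : A := brace_sigma_inv y (brace_sigma y a b) a.

Lemma sigma_tau a b : brace_sigma y (brace_sigma y a b) (brace_tau b a) = a.
Proof. exact: brace_sigma_invK. Qed.

Lemma sigma_congr i a a' b b' :
  iter i D (a - a') = 0 -> iter i D (b - b') = 0 ->
  iter i D (brace_sigma y a b - brace_sigma y a' b') = 0.
Proof.
move=> Ha Hb; rewrite -(subrK (brace_sigma y a' b) (brace_sigma y a b)) -addrA.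
rewrite sigmaBl sigmaBr iter_bmulD !iter_bmul_lam Hb lamr0 addr0 -iterSr /= Ha.
by rewrite bmulr0 lamr0.
Qed.

(** By [sigmaBl] the first arguments need to agree only after multiplication by y^(i+1). Combined
    with [sigma_tau], this yields congruences for [brace_tau] without expanding its formula. *)
Lemma sigma_cancel_congr i s s' t t' :
  iter i.+1 D (s - s') = 0 ->
  iter i D (brace_sigma y s t - brace_sigma y s' t') = 0 ->
  iter i D (t - t') = 0.
Proof.
move=> Hs; rewrite -(subrK (brace_sigma y s' t) (brace_sigma y s t)) -addrA.
rewrite sigmaBl sigmaBr (iter_bmulD i (lam t _)) (iter_bmul_lam i t) -iterSr Hs lamr0 add0r.
exact: iter_lam_eq0.
Qed.

Lemma tau_congr i a a' b b' :
  iter i D (a - a') = 0 -> iter i D (b - b') = 0 ->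
  iter i D (brace_tau b a - brace_tau b' a') = 0.
Proof.
move=> Ha Hb; have Hs := sigma_congr Ha Hb.
apply: (@sigma_cancel_congr _ (brace_sigma y a b) (brace_sigma y a' b')).
  by rewrite /= Hs bmulr0.
by rewrite !sigma_tau.
Qed.

Lemma tau_congrl i a b b' :
  iter i.+1 D (b - b') = 0 -> iter i D (brace_tau b a - brace_tau b' a) = 0.
Proof.
move=> Hb; apply: (@sigma_cancel_congr _ (brace_sigma y a b) (brace_sigma y a b')).
  by apply: sigma_congr; rewrite ?subrr ?iter_bmul0.
by rewrite !sigma_tau subrr iter_bmul0.
Qed.
End Iter.
End CommutativeBrace.

(* A solution [S] is presented when it is the set of classes of the solution
   [r_y] on [A] modulo [y ^ i (a - b) = 0]; the [i]-th retract of [r_y] is. *)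
Record presents (A : braceType) (y : A) (i : nat) (S : ybmap) (f : A -> S) : Prop :=
  Presents {
    presents_surj : forall s, exists a, f a = s;
    presents_ker : forall a b, f a = f b <-> iter i (bmul y) (a - b) = 0;
    presents_sigma : forall a b, sigma (f a) (f b) = f (brace_sigma y a b);
    presents_tau : forall a b, tau (f b) (f a) = f (brace_tau y b a)
  }.

Section Retractions.
Variables (A : braceType) (circC : forall a b : A, (a * b)%g = (b * a)%g) (y : A).

Lemma presents_brace : presents y 0 (id : A -> brace_yb y).
Proof. by split=> // [s|a b]; [exists s | split=> [->|/subr0_eq]; rewrite ?subrr]. Qed.

(** Comparing the two [sigma] at the single point [f 0] already gives y^(i+1) (a - b) = 0.
    Conversely this equation forces equality of [tau] too, by [tau_congrl]. *)
Lemma presents_sigma_tau i (S : ybmap) (f : A -> S) a b : presents y i f ->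
  (sigma (f a) = sigma (f b) /\ tau (f a) = tau (f b)) <->
  iter i.+1 (bmul y) (a - b) = 0.
Proof.
case=> fs fk fsig ftau; split=> [[Hs _]|H].
  have := congr1 (fun g => g (f 0)) Hs; rewrite !fsig => /fk.
  by rewrite (sigmaBl circC) => /(iter_lam_eq0 circC); rewrite -iterSr.
split; apply/funext => s; have [c <-] := fs s.
  rewrite !fsig; apply/fk.
  by rewrite (sigmaBl circC) (iter_bmul_lam circC) -iterSr H lamr0.
by rewrite !ftau; apply/fk; apply: tau_congrl.
Qed.

Lemma presents_Ret i (S : ybmap) (f : A -> S) : presents y i f ->
  presents y i.+1 (fun a => \pi_(ret_set S)%qT (f a) : Ret S).
Proof.
move=> P; have piE a b : \pi_(ret_set S)%qT (f a) = \pi_(ret_set S)%qT (f b) <->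
    iter i.+1 (bmul y) (a - b) = 0.
  by split=> [/ret_piP/(presents_sigma_tau _ _ P)|/(presents_sigma_tau _ _ P)/ret_piP].
(* [Ret] computes on representatives; these are congruent to the given elements, and the congruence
   lemmas absorb the choice. *)
have reprE a : exists2 a', repr (\pi_(ret_set S)%qT (f a)) = f a' &
    iter i.+1 (bmul y) (a' - a) = 0.
  have [a' a'E] := presents_surj P (repr (\pi_(ret_set S)%qT (f a))).
  by exists a' => //; apply/piE; rewrite a'E reprK.
split=> [s|//|a b|a b].
- have [a aE] := presents_surj P (repr s).
  by exists a; rewrite aE reprK.
- have [[a' aE Ha] [b' bE Hb]] := (reprE a, reprE b).
  rewrite /sigma /yb /= aE bE -/(sigma (f a') (f b')) (presents_sigma P).
  by apply/piE/sigma_congr.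
- have [[a' aE Ha] [b' bE Hb]] := (reprE a, reprE b).
  rewrite /tau /yb /= aE bE -/(tau (f b') (f a')) (presents_tau P).
  by apply/piE/tau_congr.
Qed.

Lemma presents_iter_Ret (S : ybmap) (f : A -> S) i : presents y 0 f ->
  exists g : A -> iter i Ret S, presents y i g.
Proof.
move=> P; elim: i => [|i [g Pg]]; first by exists f.
by exists (fun a => \pi_(ret_set (iter i Ret S))%qT (g a)); apply: presents_Ret.
Qed.
End Retractions.

(** * The solution [r_y] of such a brace *)

Lemma symKV (X : Type) (s : sym X) : cancel (s^-1)%g s.
Proof. by move=> a; have := congr1 (fun t : sym X => t a) (mulgV s). Qed.

Lemma finite_inj_bij (T : choiceType) (f : T -> T) :
  finite_set [set: T] -> injective f -> bijective f.
Proof.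
move=> finT f_inj; pose F := fset_set [set: T].
have inF x : x \in F by rewrite in_fset_set ?inE.
have FE : (f @` F)%fset = F.
  apply/eqP; rewrite eqEfcard card_imfset //= leqnn andbT.
  by apply/fsubsetP => x _; exact: inF.
have surj x : exists z, f z = x.
  by have := inF x; rewrite -FE => /imfsetP[z _ ->]; exists z.
have [g fg] := choice surj.
by exists g => // x; apply: f_inj; rewrite fg.
Qed.

Section BraceSolutionTheory.
Variables (A : braceType) (circC : forall a b : A, (a * b)%g = (b * a)%g) (y : A).
Implicit Types a b c : A.
Local Notation S := (brace_yb y).
Local Notation D := (bmul y).

(** Both sides are the sum of [lam a y] and [lam (brace_sigma y a b) y]. Since [brace_sigma y a] is
    multiplication by [lam a y], this is the first component of the braid equation. *)
Lemma lam_cocycle a b :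
  (lam a y * lam b y)%g =
  (lam (brace_sigma y a b) y * lam (brace_tau y b a) y)%g.
Proof.
rewrite [LHS]mulg_lam -lamM [RHS]mulg_lam -lamM.
by rewrite -[(lam (brace_sigma y a b) y * _)%g]/(brace_sigma y _ _) sigma_tau addrC.
Qed.

Lemma brace_yb_involutive : yb_involutive S.
Proof.
case=> a b; rewrite /yb /=; set s := brace_sigma y a b.
rewrite (brace_sigma_invK y s a); congr pair.
exact: brace_sigmaK.
Qed.

Lemma brace_yb_braid : @r12 S \o @r23 S \o @r12 S =1 @r23 S \o @r12 S \o @r23 S.
Proof.
case=> -[a b] c; rewrite /r12 /r23 /yb /=.
rewrite -/(brace_tau y b a) -/(brace_tau y c b).
set s := brace_sigma y a b; set t := brace_tau y b a.
rewrite -/(brace_tau y c t); set tc := brace_sigma y t c.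
rewrite -/(brace_tau y tc s); set bc := brace_sigma y b c.
rewrite -/(brace_tau y bc a); set a' := brace_tau y bc a.
rewrite -/(brace_tau y (brace_tau y c b) a').
have PE : brace_sigma y s tc = brace_sigma y a bc.
  by rewrite /brace_sigma !mulgA (lam_cocycle a b).
have QE : brace_tau y tc s = brace_sigma y a' (brace_tau y c b).
  rewrite {1}/brace_tau PE /brace_sigma_inv; apply: (mulgI (lam (brace_sigma y a bc) y)).
  rewrite mulVKg {2}/brace_sigma mulgA -lam_cocycle -mulgA.
  by congr (_ * _)%g; rewrite -{1}(sigma_tau y b c).
congr (_, _, _) => //.
(* After multiplication by these two elements, [sigma_tau] reduces both third components to a. *)
apply: (mulgI (lam (brace_sigma y a' (brace_tau y c b)) y)).
apply: (mulgI (lam (brace_sigma y a bc) y)).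
rewrite [X in _ = (_ * X)%g](sigma_tau y a' (brace_tau y c b)).
rewrite [RHS](sigma_tau y a bc) mulgA -QE -PE -lam_cocycle -mulgA.
by rewrite [X in (_ * X)%g](sigma_tau y t c); apply: sigma_tau.
Qed.

(* Conjugates each [tau b] to the inverse of [sigma b], so that the [tau b]
   commute along with the [sigma b]. *)
Definition diag_map a := brace_sigma_inv y a a.

Lemma diag_map_tau b a : diag_map (brace_tau y b a) = brace_sigma_inv y b (diag_map a).
Proof.
rewrite /diag_map {2}/brace_tau /brace_sigma_inv !mulgA -!invgM.
by congr (_^-1 * _)%g; rewrite -lam_cocycle circC.
Qed.

Hypothesis (N : nat) (nilpD : forall a, iter N D a = 0).

(** If the values at a and a' agree, d = a - a' equals y d up to some [lam], hence y^i d up to some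
    [lam] for every i, and nilpotency gives d = 0. *)
Lemma diag_map_inj : injective diag_map.
Proof.
move=> a a' Ua; apply/eqP; rewrite -subr_eq0; apply/eqP.
have aE c : c = diag_map c + lam (diag_map c) (lam c y).
  by rewrite -mulg_lam circC; apply/esym/brace_sigma_invK.
have dE : a - a' = lam (diag_map a) (D (a - a')).
  rewrite [LHS](congr2 (fun u v => u - v) (aE a) (aE a')) Ua opprD addrACA subrr.
  by rewrite add0r -lamB !(lam_bmul circC _ y) opprD addrACA subrr add0r -bmulBr.
suff H i : exists b, a - a' = lam b (iter i D (a - a')).
  by have [b ->] := H N; rewrite nilpD lamr0.
elim: i => [|i [b IHi]]; first by exists 1%g; rewrite lam1.
exists (b * diag_map a)%g; rewrite {1}IHi lamM iterSr.
by rewrite -(iter_bmul_lam circC y i (diag_map a)) -dE.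
Qed.

Hypothesis finA : finite_set [set: A].

Lemma diag_map_bij : bijective diag_map.
Proof. by apply: finite_inj_bij; last exact: diag_map_inj. Qed.

Lemma brace_sigma_bij a : bijective (brace_sigma y a).
Proof. by exists (brace_sigma_inv y a); [exact: brace_sigmaK|exact: brace_sigma_invK]. Qed.

Lemma brace_tau_bij b : bijective (brace_tau y b).
Proof.
have [U' UK U'K] := diag_map_bij.
exists (U' \o brace_sigma y b \o diag_map) => a /=.
  by rewrite diag_map_tau brace_sigma_invK UK.
by apply: diag_map_inj; rewrite diag_map_tau U'K brace_sigmaK.
Qed.

Lemma brace_yb_solution : is_solution S.
Proof.
split=> [|||a|b].
- exact: (inhabits (0 : A)).
- by exists (@yb S); exact: brace_yb_involutive.
- exact: brace_yb_braid.
- exact: brace_sigma_bij.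
- exact: brace_tau_bij.
Qed.

Lemma brace_yb_abelian : abelian_permutation_group S.
Proof.
move=> g h Gg Gh.
(* Pairs acting by multiplication by one c, directly in the first component and through [diag_map]
   in the second. Such pairs commute because the circle operation does. *)
pose K := [set k : sym S * sym S | exists c : A,
  (forall a : A, k.1 a = (c * a)%g) /\
  (forall a : A, diag_map (k.2 a) = (c * diag_map a)%g)].
have subK : permutation_group (S := S) `<=` K.
  apply: smallest_sub; last first.
    move=> k [x [k1 k2]]; exists (lam x y); split=> a; first by rewrite k1.
    have {2}-> : a = brace_tau y x (k.2 a).
      by have := symKV (k.2)^-1%g a; rewrite invgK k2.
    by rewrite diag_map_tau; apply/esym/brace_sigma_invK.
  split; first by apply/mem_set; exists 1%g; split=> a; rewrite mul1g.
  move=> k l /set_mem[c [k1 k2]] /set_mem[c' [l1 l2]]; apply/mem_set.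
  exists (c * c'^-1)%g; split=> a /=.
    by rewrite k1 -mulgA; congr (_ * _)%g; rewrite -{2}(symKV l.1 a) l1 mulKg.
  by rewrite k2 -mulgA; congr (_ * _)%g; rewrite -{2}(symKV l.2 a) l2 mulKg.
have [c [g1 g2]] := subK _ Gg; have [c' [h1 h2]] := subK _ Gh.
rewrite /commute; congr pair; apply: symP => a /=.
  by rewrite g1 h1 h1 g1 !mulgA (circC c).
by apply: diag_map_inj; rewrite g2 h2 h2 g2 !mulgA (circC c).
Qed.

Hypothesis genA : gen_zmod [set lam a y | a in [set: A]] = [set: A].

Lemma brace_yb_indecomposable : indecomposable S.
Proof.
rewrite /indecomposable; set G := gen_group _.
have [G1 GB] : group_closed (fun g => g \in G).
  split=> [|g h gG hG]; apply/mem_set => H [HC HG]; first exact/set_mem/HC.1.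
  by apply/set_mem/HC.2; apply/mem_set; [exact: (set_mem gG)|exact: (set_mem hG)].
pose H := [set c : A | exists2 g : sym S, G g & forall a : A, g a = (c * a)%g].
have H1 : H 1%g by exists 1%g; [exact: set_mem | move=> a; rewrite mul1g].
have HB c c' : H c -> H c' -> H (c * c'^-1)%g.
  move=> [g gG gE] [h hG hE]; exists (g * h^-1)%g.
    by apply/set_mem/GB; exact: mem_set.
  move=> a /=; rewrite gE -mulgA; congr (_ * _)%g.
  by rewrite -{2}(symKV h a) hE mulKg.
have HM c c' : H c -> H c' -> H (c * c')%g.
  by move=> Hc /(HB _ _ H1); rewrite mul1g => /(HB _ _ Hc); rewrite invgK.
have Hlam a : H (lam a y).
  exists (Sym (brace_sigma_bij a)) => //.
  by apply: sub_gen_smallest; exists a; left.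
(* An additive step by an orbit element is a circle step by another orbit element. So H, closed
   under circle products and inverses, is stable under adding and subtracting additive
   generators. *)
have HD c a : H c -> H (c + lam a y).
  move=> Hc; suff -> : c + lam a y = (c * lam (c^-1 * a)%g y)%g by exact: HM.
  by rewrite [RHS]mulg_lam -lamM mulVKg.
have HN c a : H c -> H (c - lam a y).
  move=> Hc; set k := c - lam a y.
  have kE : c = (k * lam (k^-1 * a)%g y)%g by rewrite mulg_lam -lamM mulVKg subrK.
  by rewrite -(mulgK (lam (k^-1 * a)%g y) k) -kE; exact: HB.
have HA c : H c.
  pose K := [set b : A | forall c, (H c -> H (c + b)) /\ (H c -> H (c - b))].
  suff /(_ c) : setT `<=` K.
    by case/(_ I 1%g) => /(_ H1) + _; rewrite brace10 add0r.
  rewrite -genA; apply: smallest_sub; last by move=> _ [a _ <-] c'; split; [exact: HD|exact: HN].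
  split; first by apply/mem_set => b; rewrite subr0 addr0.
  move=> u v /set_mem Ku /set_mem Kv; apply/mem_set => b; split=> Hb.
    have -> : b + (u - v) = b + u - v by exact: addrA.
    by apply: (Kv _).2; exact: (Ku _).1.
  have -> : b - (u - v) = b - u + v by rewrite opprB addrA addrAC.
  by apply: (Kv _).1; exact: (Ku _).2.
move=> a b; have [g gG gE] := HA (b * a^-1)%g.
by exists g => //; rewrite gE mulgVK.
Qed.
End BraceSolutionTheory.

(** * Triangular bases of lattices *)

Lemma eq_residue (x x' q m : int) :
  0 <= x < m -> 0 <= x' < m -> x - x' = q * m -> x = x'.
Proof.
move=> /andP[x0 xm] /andP[x0' xm'] E; have : q = 0 by nia.
by move=> q0; move: E; rewrite q0 mul0r => /subr0_eq.
Qed.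

Lemma subgroupMz (V : zmodType) (H : set V) (q : int) (v : V) :
  H 0 -> (forall u w : V, H u -> H w -> H (u - w)) -> H v -> H (v *~ q).
Proof.
move=> H0 HB Hv; have HN u : H u -> H (- u) by move=> /(HB _ _ H0); rewrite sub0r.
have HX k : H (v *+ k).
  by elim: k => [|k /HN/(HB _ _ Hv)]; rewrite ?mulr0n // opprK mulrS.
by case: q => k; [exact: HX | apply/HN/HX].
Qed.

Section HermiteBasis.
Variable n : nat.
Implicit Types u v w : 'rV[int]_n.

Definition vanish (k : nat) v := forall j : 'I_n, (j < k)%N -> v ord0 j = 0.

(* [b] is a triangular basis of the subgroup [L], with diagonal [m]; that it
   generates [L] follows from [hermite_lead], see [hermite_span]. *)
Record hermite (L : set 'rV[int]_n) (m : 'I_n -> nat) (b : 'I_n -> 'rV[int]_n) : Prop :=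
  Hermite {
    hermite0 : L 0;
    hermiteB : forall u v, L u -> L v -> L (u - v);
    hermite_gt0 : forall i, (0 < m i)%N;
    hermite_mem : forall i, L (b i);
    hermite_vanish : forall i : 'I_n, vanish i (b i);
    hermite_diag : forall i, b i ord0 i = (m i)%:Z;
    hermite_lead : forall v (i : 'I_n), L v -> vanish i v -> exists q, v ord0 i = q * (m i)%:Z
  }.

Lemma row_mulz v (q : int) j : (v *~ q) ord0 j = q * v ord0 j.
Proof. by rewrite -scaler_int mxE intz. Qed.

Section Reduction.
Variables (L : set 'rV[int]_n) (m : 'I_n -> nat) (b : 'I_n -> 'rV[int]_n).
Hypothesis Lmb : hermite L m b.
Let L0 := hermite0 Lmb.
Let LB := hermiteB Lmb.

Let LMz q i : L (b i *~ q).
Proof. exact: (subgroupMz q L0 LB (hermite_mem Lmb i)). Qed.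

Lemma vanish_sub k u v : vanish k u -> vanish k v -> vanish k (u - v).
Proof. by move=> Hu Hv j jk; rewrite !mxE Hu // Hv // subr0. Qed.

Lemma vanish_mulz k q v : vanish k v -> vanish k (v *~ q).
Proof. by move=> Hv j jk; rewrite row_mulz Hv // mulr0. Qed.

(** Division with remainder, column by column from k to the right: subtracting a multiple of [b i]
    does not disturb the columns before i. *)
Lemma hermite_reduce k v : exists w, [/\ L (v - w),
  forall j : 'I_n, (j < k)%N -> w ord0 j = v ord0 j &
  forall j : 'I_n, (k <= j)%N -> 0 <= w ord0 j < (m j)%:Z].
Proof.
have [t kt] : exists t, (n - k <= t)%N by exists (n - k)%N.
elim: t => [|t IHt] in k v kt *; last have [kn|nk] := ltnP k n.
- exists v; split; rewrite ?subrr // => j kj.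
  by move: kt; rewrite leqn0 subn_eq0 leqNgt (leq_ltn_trans kj).
- pose i := Ordinal kn; pose v' := v - b i *~ (v ord0 i %/ (m i)%:Z)%Z.
  have [|w [Lw wlt wge]] := IHt k.+1 v'.
    by rewrite subnS -ltnS (leq_trans _ kt) // prednK // subn_gt0.
  exists w; split=> [|j jk|j].
  + have -> : v - w = v' - w - b i *~ - (v ord0 i %/ (m i)%:Z)%Z.
      by rewrite mulrNz opprK addrAC subrK.
    exact: LB.
  + rewrite wlt ?(ltnW jk) // 1?ltnS ?(ltnW jk) // !mxE row_mulz.
    by rewrite (hermite_vanish Lmb) // mulr0 subr0.
  + rewrite leq_eqVlt => /predU1P[kj|kj]; last exact: wge.
    have -> : j = i by apply: val_inj; rewrite /= -kj.
    rewrite wlt // !mxE row_mulz (hermite_diag Lmb).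
    rewrite -[X in _ <= X < _]/(v ord0 i %% (m i)%:Z)%Z.
    rewrite modz_ge0 ?ltz_pmod ?ltz_nat ?(hermite_gt0 Lmb) //.
    by rewrite -lt0n (hermite_gt0 Lmb).
- exists v; split; rewrite ?subrr // => j kj.
  by have := leq_ltn_trans (leq_trans nk kj) (ltn_ord j); rewrite ltnn.
Qed.

Lemma hermite_unique w w' : L (w - w') ->
  (forall j, 0 <= w ord0 j < (m j)%:Z) -> (forall j, 0 <= w' ord0 j < (m j)%:Z) ->
  w = w'.
Proof.
move=> Lww wm wm'; apply/subr0_eq/rowP => j; rewrite [RHS]mxE.
suff H k : vanish k (w - w') by apply: (H n); exact: ltn_ord.
elim: k {j} => [j|k IHk j]; first by rewrite ltn0.
rewrite ltnS leq_eqVlt => /predU1P[jk|]; last exact: IHk.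
rewrite -jk in IHk; have [q] := hermite_lead Lmb Lww IHk.
rewrite !mxE => E; apply/eqP; rewrite subr_eq0; apply/eqP.
exact: eq_residue (wm j) (wm' j) E.
Qed.

(** Elimination from column k on. With k = 0 it shows that [b] generates [L]; with larger k it gives
    the shift condition of [calM]. *)
Lemma hermite_span k (H : set 'rV[int]_n) v : H 0 ->
  (forall u w, H u -> H w -> H (u - w)) -> (forall l : 'I_n, (k <= l)%N -> H (b l)) ->
  L v -> vanish k v -> H v.
Proof.
move=> H0 HB Hb; have [t kt] : exists t, (n - k <= t)%N by exists (n - k)%N.
elim: t => [|t IHt] in k v kt Hb *; last have [kn|nk] := ltnP k n.
- move=> _ vk; have -> // : v = 0.
  apply/rowP => j; rewrite mxE vk //.
  by rewrite (leq_trans (ltn_ord j)) // -subn_eq0 -leqn0.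
- move=> Lv vk; pose i := Ordinal kn; have [q vE] := hermite_lead Lmb Lv (i := i) vk.
  rewrite -(subrK (b i *~ q) v) -[X in _ + X]opprK; apply: (HB); last first.
    by rewrite -mulrNz; apply: (subgroupMz _ H0 HB); exact: Hb.
  apply: (IHt k.+1).
  + by rewrite subnS -ltnS (leq_trans _ kt) // prednK // subn_gt0.
  + by move=> l kl; apply: Hb; exact: ltnW.
  + by apply: LB => //; exact: LMz.
  + move=> j; rewrite ltnS leq_eqVlt => /predU1P[jk|jk].
      have -> : j = i by apply: val_inj.
      by rewrite !mxE row_mulz (hermite_diag Lmb) vE subrr.
    by apply: (vanish_sub (k := k)) => //; apply: vanish_mulz; exact: (@hermite_vanish _ _ _ Lmb i).
- move=> _ vk; have -> // : v = 0.
  by apply/rowP => j; rewrite mxE vk // (leq_trans (ltn_ord j)).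
Qed.
End Reduction.

(** Let [m k] be the least positive entry in column k of the vectors of [L] vanishing before k; N
    e_k shows that one exists. A nonzero remainder modulo [m k] would be a smaller such entry. *)
Lemma hermite_exists (L : set 'rV[int]_n) (N : nat) : L 0 ->
  (forall u v, L u -> L v -> L (u - v)) -> (0 < N)%N -> (forall v, L (v *+ N)) ->
  exists m b, hermite L m b.
Proof.
move=> L0 LB N0 LN.
pose Q (k : 'I_n) a := `[< (0 < a)%N /\ exists v, [/\ L v, vanish k v & v ord0 k = a%:Z] >].
have exQ k : exists a, Q k a.
  exists N; apply/asboolP; split=> //; exists (delta_mx ord0 k *+ N); split=> //.
    move=> j jk; rewrite pmulrn row_mulz mxE.
    by have [jE|] := eqVneq j k; [rewrite jE ltnn in jk | rewrite andbF mulr0].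
  by rewrite pmulrn row_mulz mxE !eqxx mulr1.
have /choice[m mP] : forall k, exists a, Q k a /\ forall a', Q k a' -> (a <= a')%N.
  by move=> k; case: (ex_minnP (exQ k)) => a Qa aP; exists a.
have /choice[b bP] : forall k : 'I_n, exists v, [/\ L v, vanish k v & v ord0 k = (m k)%:Z].
  by move=> k; have [/asboolP[_]] := mP k.
have m_gt0 k : (0 < m k)%N by have [/asboolP[]] := mP k.
exists m, b; split=> // [i|i|i|v i Lv vi]; try by have [] := bP i.
have [Lb bv bd] := bP i.
exists (v ord0 i %/ (m i)%:Z)%Z; rewrite {1}(divz_eq (v ord0 i) (m i)%:Z).
have := modz_ge0 (v ord0 i) (d := (m i)%:Z); have := ltz_pmod (v ord0 i) (d := (m i)%:Z).
rewrite ltz_nat m_gt0 -lt0n => /(_ isT) rlt /(_ (m_gt0 i)) r0.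
have [-> | rn0] := eqVneq (v ord0 i %% (m i)%:Z)%Z 0; first by rewrite addr0.
have := (mP i).2 (absz (v ord0 i %% (m i)%:Z)%Z).
rewrite leqNgt -ltz_nat gez0_abs // rlt => min_m.
suff /min_m : Q i (absz (v ord0 i %% (m i)%:Z)%Z) by [].
apply/asboolP; split; first by rewrite absz_gt0.
exists (v - b i *~ (v ord0 i %/ (m i)%:Z)%Z); split.
- exact: LB Lv (subgroupMz _ L0 LB Lb).
- by apply: vanish_sub => //; apply: vanish_mulz.
- by rewrite gez0_abs // !mxE row_mulz bd.
Qed.
End HermiteBasis.

(** * Cardinality of a shifted quotient of a lattice *)

Section Shift.
Variable n : nat.
Implicit Types v w : 'rV[int]_n.

Lemma shift_row_ord0 v (j : 'I_n) : j = 0 :> nat -> shift_row v ord0 j = 0.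
Proof. by move=> j0; rewrite mxE /= j0. Qed.

Lemma shift_row_succ v (j j' : 'I_n) : j = j'.+1 :> nat -> shift_row v ord0 j = v ord0 j'.
Proof.
move=> jE; rewrite mxE /= jE /=; congr (v _ _); apply: val_inj => /=.
by rewrite jE addSn /= modnDr modn_small.
Qed.

Lemma iter_shift_lt i v : vanish i (iter i (@shift_row n) v).
Proof.
elim: i => // i IHi j; rewrite ltnS iterS => ji.
have [j0|j_gt0] := posnP j; first exact: shift_row_ord0.
have j'n : (j.-1 < n)%N by rewrite (leq_ltn_trans (leq_pred j)).
rewrite (shift_row_succ _ (j' := Ordinal j'n)) /= ?prednK //; apply: IHi => /=.
by rewrite prednK.
Qed.

Lemma iter_shift_add i v (j j' : 'I_n) : j = (i + j')%N :> nat ->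
  iter i (@shift_row n) v ord0 j = v ord0 j'.
Proof.
elim: i j => [|i IHi] j /= jE; first by congr (v _ _); apply: val_inj.
have kn : (i + j' < n)%N by rewrite -ltnS -addSn -jE ltnS ltnW.
by rewrite (shift_row_succ _ (j' := Ordinal kn)) // IHi.
Qed.

Lemma unshift i w : vanish i w -> exists v, iter i (@shift_row n) v = w.
Proof.
(* The shift to the left by i, padded with zeros where [insub] finds i + j out of range. *)
move=> wi; exists (\row_j (if insub (i + j)%N is Some k then w ord0 k else 0)).
apply/rowP => j; have [ji|ij] := ltnP j i.
  by rewrite wi //; apply: iter_shift_lt.
have jn : (j - i < n)%N by rewrite (leq_ltn_trans (leq_subr i j)).
rewrite (iter_shift_add _ (j' := Ordinal jn)) /= ?subnKC // mxE /=.
by rewrite subnKC // valK.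
Qed.

Lemma shift_rowB : {morph @shift_row n : v w / v - w}.
Proof. by move=> v w; apply/rowP => j; rewrite !mxE; case: ifP => _; rewrite ?subr0. Qed.

Lemma iter_shiftB i : {morph iter i (@shift_row n) : v w / v - w}.
Proof. by elim: i => //= i IHi v w /=; rewrite IHi shift_rowB. Qed.
End Shift.

Lemma yb_card_param (F : finType) (P : {pred F}) (S : ybmap) (g : F -> S) :
  {in P &, injective g} -> (forall s, exists2 c, c \in P & g c = s) ->
  finite_set [set: S] /\ yb_card S = #|P|.
Proof.
move=> g_inj g_surj; have SE : [set: S] = g @` [set` P].
  by apply/seteqP; split=> // s _; have [c cP cs] := g_surj s; exists c.
have finS : finite_set [set: S] by rewrite SE; apply/finite_image/finite_finset.
split=> //; rewrite /yb_card.
have -> : fset_set [set: S] = [fset g c | c in P]%fset.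
  apply/fsetP => s; rewrite in_fset_set // in_setT; apply/esym/imfsetP.
  by have [c cP cs] := g_surj s; exists c.
by rewrite card_in_imfset //= -cardE.
Qed.

Lemma card_ltn_ord (B k : nat) : (k <= B)%N -> #|[pred c : 'I_B | (c < k)%N]| = k.
Proof.
move=> kB; rewrite -sum1_card (big_ord_narrow kB).
by rewrite sum1_card card_ord.
Qed.

(** The classes correspond to the reduced remainders modulo [L] of the shifted vectors: the entries
    before column i stay 0, the others range freely below [m j], and [unshift] realizes each
    remainder. *)
Lemma hermite_card (n : nat) (L : set 'rV[int]_n) m b i (S : ybmap)
    (f : 'rV[int]_n -> S) : hermite L m b ->
  (forall s, exists v, f v = s) ->
  (forall v w, f v = f w <-> L (iter i (@shift_row n) (v - w))) ->
  finite_set [set: S] /\ yb_card S = (\prod_(j < n | (i <= j)%N) m j)%N.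
Proof.
move=> Lmb f_surj fE.
(* A side of length 1 forces the entry 0 before column i. B is a positive common bound, which places
   the box inside a finite type. *)
pose B := (\sum_j m j).+1; pose k (j : 'I_n) := if (i <= j)%N then m j else 1%N.
have kB j : (k j <= B)%N.
  by rewrite /k; case: ifP => // _; rewrite ltnW // ltnS (bigD1 j) //= leq_addr.
have k_le j : (k j <= m j)%N by rewrite /k; case: ifP => // _; exact: (hermite_gt0 Lmb).
pose P := family (fun j => [pred c : 'I_B | (c < k j)%N]).
pose r (c : {ffun 'I_n -> 'I_B}) : 'rV[int]_n := \row_j (c j : nat)%:Z.
have rP c : c \in P -> forall j, (c j < k j)%N by move/familyP.
have r_van c : c \in P -> vanish i (r c).
  move=> cP j ji; have := rP c cP j; rewrite mxE /k (leqNgt i j) ji /=.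
  by rewrite ltnS leqn0 => /eqP ->.
have r_box c : c \in P -> forall j, 0 <= r c ord0 j < (m j)%:Z.
  by move=> cP j; rewrite mxE lez_nat ltz_nat /= (leq_trans (rP c cP j)).
have /choice[u uP] : forall c, exists v, c \in P -> iter i (@shift_row n) v = r c.
  move=> c; have [cP|] := boolP (c \in P); last by exists 0.
  by have [v vE] := unshift (r_van c cP); exists v.
have -> : (\prod_(j < n | (i <= j)%N) m j)%N = #|P|.
  rewrite card_family foldrE big_map big_enum /= big_mkcond.
  by apply: eq_bigr => j _; rewrite card_ltn_ord.
apply: (@yb_card_param _ P _ (fun c => f (u c))) => [c c' cP c'P|s].
  move=> /fE; rewrite iter_shiftB !uP // => H.
  have := hermite_unique Lmb H (r_box c cP) (r_box c' c'P) => rE.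
  apply/ffunP => j; apply: val_inj.
  by have := congr1 (fun w : 'rV[int]_n => w ord0 j) rE; rewrite !mxE => -[].
have [v <-] := f_surj s.
have [w [Lw w0 w_box]] := hermite_reduce Lmb i (iter i (@shift_row n) v).
have {}w0 (j : 'I_n) : (j < i)%N -> w ord0 j = 0.
  by move=> ji; rewrite w0 //; apply: iter_shift_lt.
have w_ge0 j : 0 <= w ord0 j.
  by have [ij|ji] := leqP i j; [case/andP: (w_box j ij) | rewrite w0].
have w_lt j : (absz (w ord0 j) < k j)%N.
  rewrite /k; case: (leqP i j) => [ij|ji]; last by rewrite w0.
  by rewrite -ltz_nat gez0_abs //; case/andP: (w_box j ij).
pose c := [ffun j => inord (absz (w ord0 j)) : 'I_B].
have cE j : c j = absz (w ord0 j) :> nat.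
  by rewrite ffunE inordK // (leq_trans (w_lt j)).
have cP : c \in P by apply/familyP => j; rewrite inE cE.
exists c => //; apply/esym/fE; rewrite iter_shiftB uP //.
by have -> : r c = w by apply/rowP => j; rewrite mxE cE gez0_abs.
Qed.


(** * Matrices in [calM] and shift-stable lattices *)

Section RowLattice.
Variables (p n : nat) (d : 'I_n -> nat).

Lemma calM_hermite (M : calM p d) : prime p ->
  hermite (gen_zmod [set row k M | k in [set: 'I_n]]) (fun i => p ^ d i)%N
    (fun i => row i M).
Proof.
move=> p_prime; split=> [|u v|i|i|i j ji|i|v i].
- exact: gen_zmod0.
- exact: gen_zmodB.
- by rewrite expn_gt0 prime_gt0.
- by apply: sub_gen_smallest; exists i.
- by rewrite mxE (calM_upper M).
- by rewrite mxE (calM_diag M).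
move=> gen_v; have [c ->] : exists c : 'rV_n, v = c *m M.
  move: v gen_v; apply: gen_zmod_sub => [|_ _ [c ->] [c' ->]|_ [k _ <-]].
  - by exists 0; rewrite mul0mx.
  - by exists (c - c'); rewrite mulmxBl.
  - by exists (delta_mx ord0 k); rewrite -rowE.
have cE (k : 'I_n) : vanish k c -> (c *m M) ord0 k = c ord0 k * M k k.
  move=> ck; rewrite mxE (bigD1 k) //= big1 ?addr0 // => j jk.
  have [jk'|] := ltnP j k; first by rewrite ck // mul0r.
  by rewrite leq_eqVlt val_eqE eq_sym (negPf jk) /= => kj; rewrite (calM_upper M) ?mulr0.
(* As M is triangular with nonzero diagonal, the coefficients before i vanish one after the
   other. *)
move=> vi; have ci k : (k <= i)%N -> vanish k c.
  elim: k => [_ j|k IHk ki j]; rewrite ?ltn0 // ltnS leq_eqVlt => /predU1P[jk|].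
    have ck : vanish j c by rewrite jk; apply: IHk; exact: ltnW.
    have := vi j; rewrite jk => /(_ ki); rewrite (cE j ck) => /eqP.
    rewrite mulf_eq0 (calM_diag M) => /orP[/eqP //|].
    by rewrite eqz_nat expn_eq0 eqn0Ngt prime_gt0.
  by apply: IHk; exact: ltnW.
by exists (c ord0 i); rewrite (cE i (ci i _)) // (calM_diag M).
Qed.

(** Reducing row k beyond its diagonal entry yields the column condition. The shift of row k lies in
    [L] and vanishes up to column k, so [hermite_span] from k + 1 puts it in the span of the later
    rows. *)
Lemma hermite_calM (L : set 'rV[int]_n) b : prime p ->
  hermite L (fun i => p ^ d i)%N b -> (forall v, L v -> L (shift_row v)) ->
  exists M : calM p d, L = gen_zmod [set row k M | k in [set: 'I_n]].
Proof.
move=> p_prime Lb Lshift; have [L0 LB] := (hermite0 Lb, hermiteB Lb).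
have /choice[w wP] : forall k : 'I_n, exists w : 'rV[int]_n, [/\ L w,
    forall j : 'I_n, (j <= k)%N -> w ord0 j = b k ord0 j &
    forall j : 'I_n, (k < j)%N -> 0 <= w ord0 j < (p ^ d j)%:Z].
  move=> k; have [w [Lw wlt wge]] := hermite_reduce Lb k.+1 (b k).
  exists w; split=> [|j jk|//]; last exact: wlt.
  have -> : w = b k - (b k - w) by rewrite opprB addrC subrK.
  by apply: LB => //; exact: (hermite_mem Lb).
have wvan (k : 'I_n) : vanish k (w k).
  by move=> j jk; have [_ /(_ j (ltnW jk)) -> _] := wP k; exact: (hermite_vanish Lb).
have wd k : w k ord0 k = (p ^ d k)%:Z.
  by have [_ /(_ k (leqnn k)) -> _] := wP k; exact: (hermite_diag Lb).
have Lw : hermite L (fun i => p ^ d i)%N w.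
  by split=> // [i|i|v i]; [exact: (hermite_gt0 Lb) | have [] := wP i | exact: (hermite_lead Lb)].
pose M : 'M[int]_n := \matrix_(i, j) w i ord0 j.
have rowM k : row k M = w k by apply/rowP => j; rewrite !mxE.
have p_gt0 j : 0 < (p ^ d j)%:Z by rewrite ltz_nat expn_gt0 prime_gt0.
have Mupper (i j : 'I_n) : (j < i)%N -> M i j = 0 by rewrite mxE; exact: wvan.
have Mbox (i j : 'I_n) : i != j -> 0 <= M i j < (p ^ d j)%:Z.
  move=> ij; have [ji|] := ltnP j i; first by rewrite Mupper // lexx p_gt0.
  rewrite leq_eqVlt val_eqE (negPf ij) /= => ltij; rewrite mxE.
  by have [_ _] := wP i; apply.
have Mdiag i : M i i = (p ^ d i)%:Z by rewrite mxE wd.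
have Mge0 i j : 0 <= M i j.
  by have [->|/Mbox/andP[]//] := eqVneq i j; rewrite Mdiag ltW.
have Mgt (i j : 'I_n) : i != j -> M i j < M j j by move=> /Mbox/andP[_]; rewrite Mdiag.
have Mshift (k : 'I_n) : gen_zmod [set v | exists2 l : 'I_n, (k < l)%N & v = row l M]
    (shift_row (row k M)).
  apply: (hermite_span Lw (k := k.+1)).
  - exact: gen_zmod0.
  - exact: gen_zmodB.
  - by move=> l kl; apply: sub_gen_smallest; exists l; rewrite ?rowM.
  - by apply: Lshift; rewrite rowM; have [] := wP k.
  - move=> j; rewrite ltnS rowM => jk; have [j0|j_gt0] := posnP j.
      exact: shift_row_ord0.
    have j'n : (j.-1 < n)%N by rewrite (leq_ltn_trans (leq_pred j)).
    rewrite (shift_row_succ _ (j' := Ordinal j'n)) /= ?prednK //.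
    by apply: wvan; rewrite /= prednK.
exists (CalM Mupper Mge0 Mgt Mshift Mdiag); apply/seteqP; split=> v.
  move=> Lv; apply: (hermite_span Lw (k := 0)) => //.
  - exact: gen_zmod0.
  - exact: gen_zmodB.
  - by move=> l _; apply: sub_gen_smallest; exists l => //=; rewrite rowM.
by apply: gen_zmod_sub => // _ [k _ <-]; rewrite /= rowM; have [] := wP k.
Qed.
End RowLattice.

(** * From a solution to a brace *)

(* A transitive family of commuting bijections acts regularly, so it turns the
   set into an abelian group on which it acts by translations. *)
Lemma regular_group (X I : Type) (P : I -> X -> X) (e : X) :
  (forall i, bijective (P i)) -> (forall i j x, P i (P j x) = P j (P i x)) ->
  (forall H : set X, H e -> (forall i x, H x <-> H (P i x)) -> forall x, H x) ->
  exists (op : X -> X -> X) (inv : X -> X),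
    [/\ commutative op, associative op, left_id e op, left_inverse e inv op &
        forall i x, P i x = op (P i e) x].
Proof.
move=> Pbij PC reach.
(* C is the centralizer of the [P i], and B, the centralizer of C, lies in C. Maps in C are
   determined by their value at e, and B takes every value there; so X is identified with B, and
   composition becomes [op]. *)
pose C : set (X -> X) := [set t | forall i x, t (P i x) = P i (t x)].
pose B : set (X -> X) := [set t | forall s, C s -> forall x, t (s x) = s (t x)].
have BC t : B t -> C t by move=> Bt i x; apply: (Bt (P i)) => j z; exact: PC.
have uniq t t' : C t -> C t' -> t e = t' e -> forall x, t x = t' x.
  move=> Ct Ct' te; apply: reach => // i x; split=> /= [|]; rewrite Ct Ct'.
    by move->.
  exact: (bij_inj (Pbij i)).
have ex x : exists t, B t /\ t e = x.
  move: x; apply: reach => [|i x]; first by exists id.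
  split=> -[t [Bt te]].
    exists (P i \o t); split=> [s Cs z|]; rewrite /= ?te //.
    by rewrite (Bt s Cs) -Cs.
  have [Q PQ QP] := Pbij i; exists (Q \o t); split=> [s Cs z|]; rewrite /= ?te //.
  by apply: (bij_inj (Pbij i)); rewrite QP -Cs QP (Bt s Cs).
have [t tP] := choice ex.
have tB x : B (t x) by have [] := tP x.
have te x : t x e = x by have [] := tP x.
have tC x : C (t x) by exact: BC.
have PE i x : P i x = t (P i e) x.
  by apply: uniq x; [move=> j z; exact: PC | exact: tC | rewrite te].
have opC x y : t x y = t y x.
  by rewrite -{1}(te y) (tB x (t y)) ?te.
have opA x y z : t x (t y z) = t (t x y) z.
  apply: (uniq (t x \o t y)) => //=; last by rewrite !te.
  by move=> i u /=; rewrite !tC.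
have ex_inv x : exists x', t x' x = e.
  suff [x' x'E] : exists x', t x x' = e by exists x'; rewrite opC.
  move: x; apply: reach => [|i x]; first by exists e.
  have tP' x' : t (P i x) x' = P i (t x x') by rewrite (PE i x) -opA -PE.
  split=> -[x' x'E]; last by exists (P i x'); rewrite tC -tP'.
  have [Q PQ QP] := Pbij i; exists (Q x').
  by rewrite tP' -tC QP.
have [inv invP] := choice ex_inv; exists t, inv; split=> // x.
by rewrite opC te.
Qed.

(* The data left of a solution with abelian permutation group once its set is
   identified with the group: [sigma a] is the translation by [cocycle_fun a],
   [cocycle_comm] is the braid equation and [cocycle_reach] indecomposability. *)
Record cocycle := Cocycle {
  cocycle_group : groupType;
  cocycle_fun : cocycle_group -> cocycle_group;
  cocycle_mulC : forall a b : cocycle_group, (a * b)%g = (b * a)%g;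
  cocycle_comm : forall a b, (cocycle_fun a * cocycle_fun ((cocycle_fun a)^-1 * b))%g =
                             (cocycle_fun b * cocycle_fun ((cocycle_fun b)^-1 * a))%g;
  cocycle_bij : bijective (fun a => (cocycle_fun a)^-1 * a)%g;
  cocycle_reach : forall H : set cocycle_group, H 1%g ->
    (forall a x, H x <-> H (cocycle_fun a * x)%g) -> forall x, H x
}.

Section CocycleBrace.
Variable C : cocycle.
Local Notation G := (cocycle_group C).
Local Notation f := (@cocycle_fun C).
Local Notation mulC := (@cocycle_mulC C).
Implicit Types a b g h k : G.
Local Open Scope group_scope.

(* Translation by [f a] for the additive structure under construction. *)
Definition cocycle_trans a g : G := g * f (g^-1 * a).

(** With t = g^-1 a, the equation g f(t) = h becomes f(t)^-1 t = h^-1 a, which [cocycle_bij] solves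
    for t; then g = a t^-1. *)
Lemma cocycle_trans_bij a : bijective (cocycle_trans a).
Proof.
have [T UT TU] := @cocycle_bij C.
have {}UT t : T ((f t)^-1 * t) = t by exact: UT.
have {}TU u : (f (T u))^-1 * T u = u by exact: TU.
exists (fun h => a * (T (h^-1 * a))^-1) => g; rewrite /cocycle_trans.
  by rewrite invgM -mulgA UT invgM invgK mulVKg.
set t := T _; rewrite invgM invgK mulgVK -mulgA.
by rewrite -[f t]invgK -invgM TU invgM invgK mulVKg.
Qed.

Lemma cocycle_transE a g h : cocycle_trans (g * a) (g * h) = g * cocycle_trans a h.
Proof. by rewrite /cocycle_trans invgM -!mulgA mulKg. Qed.

Lemma cocycle_transC a b g :
  cocycle_trans a (cocycle_trans b g) = cocycle_trans b (cocycle_trans a g).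
Proof.
rewrite /cocycle_trans !invgM -!mulgA; congr (_ * _).
exact: cocycle_comm.
Qed.

Lemma cocycle_trans_reach (H : set G) : H 1 ->
  (forall a x, H x <-> H (cocycle_trans a x)) -> forall x, H x.
Proof.
move=> H1 HP; apply: cocycle_reach => // a x.
(* At x, the additive translation of index [x * a] agrees with multiplication by [f a]. *)
by rewrite (HP (x * a) x) /cocycle_trans mulKg mulC.
Qed.

Let add_spec := cid (regular_group cocycle_trans_bij cocycle_transC cocycle_trans_reach).
Definition cocycle_add : G -> G -> G := sval add_spec.
Let opp_spec := cid (svalP add_spec).
Definition cocycle_opp : G -> G := sval opp_spec.
Local Notation add := cocycle_add.
Local Notation opp := cocycle_opp.

Lemma cocycle_addP : [/\ commutative add, associative add, left_id 1 add,
  left_inverse 1 opp add & forall a g, cocycle_trans a g = add (cocycle_trans a 1) g].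
Proof. exact: (svalP opp_spec). Qed.

Lemma cocycle_addC : commutative add. Proof. by have [] := cocycle_addP. Qed.
Lemma cocycle_addA : associative add. Proof. by have [] := cocycle_addP. Qed.
Lemma cocycle_add0 : left_id 1 add. Proof. by have [] := cocycle_addP. Qed.
Lemma cocycle_addN : left_inverse 1 opp add. Proof. by have [] := cocycle_addP. Qed.

Lemma cocycle_transD a g : cocycle_trans a g = add (f a) g.
Proof.
have [_ _ _ _ ->] := cocycle_addP.
by rewrite /cocycle_trans invg1 !mul1g.
Qed.

Lemma cocycle_mul_fun g a : g * f a = add (f (g * a)) g.
Proof. by rewrite -cocycle_transD /cocycle_trans mulKg. Qed.

Lemma cocycle_add_inj a : injective (add a).
Proof.
move=> g h /(congr1 (add (opp a))).
by rewrite !cocycle_addA cocycle_addN !cocycle_add0.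
Qed.

(** The brace law with the subtraction moved across. Multiplication by g turns adding [f a] into
    adding [f (g * a)], so moving k by a generator adds the same term to both sides; [cocycle_reach]
    serves as induction on k. *)
Lemma cocycle_distr g h k : add (g * add h k) g = add (g * h) (g * k).
Proof.
have gD a x : g * add (f a) x = add (f (g * a)) (g * x).
  by rewrite -!cocycle_transD cocycle_transE.
move: h; apply: (cocycle_reach (H := fun k => forall h, add (g * add h k) g = add (g * h) (g * k))).
  by move=> h; rewrite mulg1 (cocycle_addC h) cocycle_add0.
move=> a x; rewrite [f a * x]mulC cocycle_mul_fun.
set c := x * a.
suff E h : (add (g * add h (add (f c) x)) g = add (g * h) (g * add (f c) x)) <->
    (add (g * add h x) g = add (g * h) (g * x)).
  by split=> H h; [apply/E | apply/(E h)].
have -> : add h (add (f c) x) = add (f c) (add h x).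
  by rewrite !cocycle_addA [add h _]cocycle_addC.
rewrite !gD -cocycle_addA [add (g * h) _]cocycle_addC -cocycle_addA.
rewrite [add (g * x) _]cocycle_addC.
by split=> [/cocycle_add_inj|->].
Qed.

Definition cocycle_brace : Type := G.
HB.instance Definition _ := Group.on cocycle_brace.
HB.instance Definition _ := GRing.isZmodule.Build cocycle_brace
  cocycle_addA cocycle_addC cocycle_add0 cocycle_addN.

Lemma cocycle_brace_distr (a b c : cocycle_brace) :
  ((a * (b + c))%g = (a * b)%g - a + (a * c)%g)%R.
Proof.
apply: (addIr a); rewrite addrAC subrK.
exact: cocycle_distr.
Qed.

HB.instance Definition _ := isBrace.Build cocycle_brace cocycle_brace_distr.

(** Identifies [f] with the orbit map of y = f 1, so that multiplication by [f a] becomes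
    [brace_sigma y a]. *)
Lemma cocycle_lam (a : cocycle_brace) : lam a (f 1 : cocycle_brace) = f a.
Proof.
rewrite /lam; apply: (addrI (a : cocycle_brace)); rewrite addrA subrr add0r.
have -> : (a + f a = add a (f a) :> cocycle_brace)%R by [].
rewrite cocycle_addC -{2}(mulg1 a); exact: cocycle_mul_fun.
Qed.

Lemma cocycle_brace_gen (y : cocycle_brace) : y = f 1 ->
  gen_zmod [set lam a y | a in [set: cocycle_brace]] = [set: cocycle_brace].
Proof.
move=> yE; apply/seteqP; split=> // x _.
set K := gen_zmod _.
have Kf a : K (f a) by apply: sub_gen_smallest; exists (a : cocycle_brace); rewrite // yE cocycle_lam.
apply: (cocycle_reach (H := K)) => [|a {}x]; first exact: gen_zmod0.
have -> : f a * x = ((f (x * a)%g : cocycle_brace) + (x : cocycle_brace))%R.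
  by rewrite mulC cocycle_mul_fun.
split=> [Kx|Kx]; first by apply: gen_zmodD; [exact: Kf | exact: Kx].
by have := gen_zmodB Kx (Kf (x * a)); rewrite addrAC subrr add0r.
Qed.
End CocycleBrace.

Section GroupOfLaws.
Variables (T : choiceType) (mul : T -> T -> T) (inv : T -> T) (e : T).
Hypotheses (mulA : associative mul) (mul1 : left_id e mul) (mulr1 : right_id e mul).
Hypotheses (mulV : left_inverse e inv mul) (mulrV : right_inverse e inv mul).

(* The unused [let] keeps the laws as parameters, so that the group structure
   can be attached to this alias of [T]. *)
Definition group_of_laws : Type := let _ := (mulA, mul1, mulr1, mulV, mulrV) in T.
HB.instance Definition _ := Choice.on group_of_laws.
HB.instance Definition _ := isGroup.Build group_of_laws mulA mul1 mulr1 mulV mulrV.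
End GroupOfLaws.

Section SolutionBrace.
Variables (S : ybmap) (solS : is_solution S) (invS : yb_involutive S).
Local Open Scope ring_scope.
Implicit Types x z : S.

Lemma sigma_bij x : bijective (sigma x). Proof. by have [_ _ _ +] := solS. Qed.
Lemma tau_bij x : bijective (tau x). Proof. by have [_ _ _ _ +] := solS. Qed.

Let yb_invol u : yb (yb u) = u :> S * S. Proof. exact: invS. Qed.

Lemma sigmaK x z : sigma (sigma x z) (tau z x) = x.
Proof. by rewrite /sigma /tau -surjective_pairing yb_invol. Qed.

Lemma tauK x z : tau (tau z x) (sigma x z) = z.
Proof. by rewrite /sigma /tau -surjective_pairing yb_invol. Qed.

Lemma sigma_sigma x z u : sigma x (sigma z u) = sigma (sigma x z) (sigma (tau z x) u).
Proof.
have [_ _ braid _ _] := solS.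
by have := congr1 (fun v : S * S * S => v.1.1) (braid (x, z, u)).
Qed.

Lemma sigma_diag u x : sigma u x = u <-> tau x u = x.
Proof.
split=> H; first by apply: (bij_inj (sigma_bij u)); rewrite H -{1}H sigmaK.
have Hs : sigma (sigma u x) x = u by rewrite -{2}H sigmaK.
apply: (bij_inj (tau_bij x)); rewrite H.
by have := tauK u x; rewrite H.
Qed.

(** The inverse sends x to the u with [tau x u = x]: by [sigma_diag] both maps describe the fixed
    points (u, x) of r. *)
Lemma sigma_diag_bij (U : S -> S) : (forall u, sigma u (U u) = u) -> bijective U.
Proof.
move=> UE; have [T TK KT] : bijective U; last by exists T.
have /choice[T TP] : forall x, exists u, tau x u = x.
  by move=> x; have [Q _ QP] := tau_bij x; exists (Q x).
exists T => u.
  apply: (bij_inj (tau_bij (U u))); rewrite TP; apply/esym/sigma_diag; exact: UE.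
apply: (bij_inj (sigma_bij (T u))); rewrite UE.
by apply/esym/sigma_diag; exact: TP.
Qed.

Hypotheses (indecS : indecomposable S) (abelS : abelian_permutation_group S).

Lemma sigmaC x z u : sigma x (sigma z u) = sigma z (sigma x u).
Proof.
have mem w : permutation_group (Sym (sigma_bij w), (Sym (tau_bij w))^-1%g).
  by apply: sub_gen_smallest; exists w; rewrite /= invgK.
by have := abelS (mem x) (mem z) => /(congr1 (fun g : sym S * sym S => g.1 u)).
Qed.

Lemma sigma_reach x (H : set S) : H x -> (forall z u, H u <-> H (sigma z u)) ->
  forall u, H u.
Proof.
move=> Hx Hsigma u; have [g Gg <-] := indecS x u.
suff /(_ g Gg x) <- : gen_group [set s : sym S |
    exists x, (s : S -> S) = sigma x \/ (s : S -> S) = tau x] `<=`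
  [set s : sym S | forall z, H z <-> H (s z)] by [].
have Hinv (s : sym S) z : (forall z, H z <-> H (s z)) -> H z <-> H (s^-1%g z).
  by move=> Hs; rewrite (Hs (s^-1%g z)) symKV.
apply: smallest_sub; last first.
  move=> s [w [sE|sE]] z; rewrite sE; first exact: Hsigma.
  (* By involutivity z is the image of [tau w z] under some [sigma], so stability under [sigma]
     suffices. *)
  by rewrite -{1}(sigmaK z w) -Hsigma.
split; first exact/mem_set.
move=> s t /set_mem Hs /set_mem Ht; apply/mem_set => z.
by rewrite /= -(Hs (t^-1%g z)); exact: Hinv.
Qed.

Lemma solution_brace : exists (B : braceType) (y : B) (h : B -> S),
  [/\ forall a b : B, (a * b)%g = (b * a)%g,
      gen_zmod [set lam a y | a in [set: B]] = [set: B], bijective h &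
      forall a b, h (brace_sigma y a b) = sigma (h a) (h b)].
Proof.
have [[e] _ _ _ _] := solS.
have [mul [inv [mC mA m1 mV mE]]] :=
  regular_group sigma_bij sigmaC (@sigma_reach e).
have m1r : right_id e mul by move=> x; rewrite mC m1.
have mVr : right_inverse e inv mul by move=> x; rewrite mC mV.
pose G : groupType := group_of_laws mA m1 m1r mV mVr.
pose f (x : G) : G := sigma x e.
have sE x z : sigma x z = (f x * z :> G)%g by exact: mE.
have fbij : bijective (fun x : G => (f x)^-1 * x)%g.
  by apply: sigma_diag_bij => u; rewrite sE mulVKg.
(* For z = f(a)^-1 b one has [sigma a z = b] and, by involutivity, tau z a = f(b)^-1 a; the claim is
   then [sigma_sigma] at e. *)
have fcomm (a b : G) : (f a * f ((f a)^-1 * b) = f b * f ((f b)^-1 * a))%g.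
  have := sigma_sigma a ((f a)^-1 * b)%g e; rewrite (sE a ((f a)^-1 * b)%g) mulVKg.
  have -> : tau ((f a)^-1 * b)%g a = ((f b)^-1 * a)%g.
    apply: (bij_inj (sigma_bij b)); rewrite [RHS]sE mulVKg.
    by have := sigmaK a ((f a)^-1 * b)%g; rewrite (sE a ((f a)^-1 * b)%g) mulVKg.
  by rewrite (sE a) (sE b).
have freach (H : set G) : H 1%g -> (forall a x, H x <-> H (f a * x)%g) -> forall x, H x.
  by move=> He HE; apply: (sigma_reach He) => z u; rewrite sE.
pose C := @Cocycle G f mC fcomm fbij freach.
exists (cocycle_brace C), (f e : G), id; split=> //.
- exact: cocycle_brace_gen.
- by exists id.
- by move=> a b; rewrite /brace_sigma (cocycle_lam (C := C)) sE.
Qed.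
End SolutionBrace.

(** * Braces as quotients of [F_n] *)

HB.instance Definition _ (A : braceType) (a : A) :=
  GRing.isZmodMorphism.Build A A (bmul a) (bmulBr a).

Section Generator.
Variables (A : braceType) (circC : forall a b : A, (a * b)%g = (b * a)%g) (y : A).
Variables (n : nat) (nilp : forall a, iter n (bmul y) a = 0).
Local Notation D := (bmul y).
Implicit Types (a b c : A) (v w : 'rV[int]_n).

Lemma iter_bmulMz i a (q : int) : iter i D (a *~ q) = iter i D a *~ q.
Proof. by elim: i => //= i ->; rewrite raddfMz. Qed.

(* Evaluation at [y] of the polynomial [v_1 x + ... + v_n x^n]. *)
Definition brace_eval v : A := \sum_(j < n) iter j D y *~ v ord0 j.

Lemma brace_evalB : zmod_morphism brace_eval.
Proof.
move=> v w; rewrite /brace_eval -sumrB; apply: eq_bigr => j _.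
by rewrite !mxE mulrzBr.
Qed.

HB.instance Definition _ :=
  GRing.isZmodMorphism.Build 'rV[int]_n A brace_eval brace_evalB.

Lemma brace_eval_eq v w : brace_eval v = brace_eval w <-> brace_eval (v - w) = 0.
Proof. by rewrite raddfB /=; split=> [->|/subr0_eq]; rewrite ?subrr. Qed.

Lemma brace_eval_delta (j : 'I_n) : brace_eval (delta_mx ord0 j) = iter j D y.
Proof.
rewrite /brace_eval (bigD1 j) //= mxE !eqxx big1 ?addr0 // => k kj.
by rewrite mxE (negPf kj) andbF mulr0z.
Qed.

Lemma bmul_brace_eval v : D (brace_eval v) = brace_eval (shift_row v).
Proof.
rewrite /brace_eval raddf_sum /=; case: n v nilp => [|m] v nil; first by rewrite !big_ord0.
(* The entry lost by the shift is the coefficient of y^(n+1), which is 0 by nilpotency. *)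
rewrite big_ord_recr [RHS]big_ord_recl /= raddfMz -iterS nil mul0rz addr0.
rewrite shift_row_ord0 // mulr0z add0r; apply: eq_bigr => j _.
by rewrite raddfMz (shift_row_succ _ (j' := widen_ord (leqnSn m) j)).
Qed.

Lemma iter_brace_eval i v :
  iter i D (brace_eval v) = brace_eval (iter i (@shift_row n) v).
Proof. by elim: i => //= i ->; rewrite bmul_brace_eval. Qed.

Lemma iter_bmulA i a b : bmul a (iter i D b) = iter i D (bmul a b).
Proof. by elim: i => //= i <-; rewrite (bmulA circC). Qed.

(** Coefficients of the product of the two polynomials modulo x^(n+1): the (j+1)-fold shift is
    multiplication by x^(j+1). *)
Definition row_conv v w : 'rV[int]_n :=
  \sum_(j < n) iter j.+1 (@shift_row n) w *~ v ord0 j.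

Lemma bmul_eval v w : bmul (brace_eval v) (brace_eval w) = brace_eval (row_conv v w).
Proof.
rewrite (bmulC circC) {2}/brace_eval raddf_sum [RHS]raddf_sum; apply: eq_bigr => j _ /=.
rewrite !raddfMz /= iter_bmulA (bmulC circC) -iterSr.
by rewrite -[shift_row _]/(iter j.+1 _ _) iter_brace_eval.
Qed.

Hypothesis n_gt0 : (0 < n)%N.

Lemma brace_eval_gen : brace_eval (delta_mx ord0 (Ordinal n_gt0)) = y.
Proof. by rewrite brace_eval_delta. Qed.

(** Lifts [brace_sigma] to coefficient rows by a formula independent of the brace, which is what
    [brace_iso] relies on; z represents [lam a y] for a the value of v. *)
Definition row_sigma v w : 'rV[int]_n :=
  let z := delta_mx ord0 (Ordinal n_gt0) + shift_row v in w + (z + row_conv w z).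

Lemma brace_sigma_eval v w :
  brace_sigma y (brace_eval v) (brace_eval w) = brace_eval (row_sigma v w).
Proof.
rewrite (sigma_lam circC) lamE (lam_bmul circC _ y) bmul_brace_eval.
have -> : y + brace_eval (shift_row v) =
    brace_eval (delta_mx ord0 (Ordinal n_gt0) + shift_row v).
  by rewrite raddfD /= brace_eval_gen.
by rewrite bmul_eval -!raddfD.
Qed.

Hypothesis gen : gen_zmod [set lam a y | a in [set: A]] = [set: A].

(** As lam b y = y + y b, every element is an integer multiple of y plus some y c'. Starting from
    y^n c = 0, this expresses y^(n-k) c as a polynomial in y for growing k. *)
Lemma brace_eval_surj a : exists v, brace_eval v = a.
Proof.
have split_gen c : exists q c', c = y *~ q + D c'.
  suff /(_ c I) : [set: A] `<=` [set c | exists q c', c = y *~ q + D c'] by [].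
  rewrite -gen; apply: gen_zmod_sub => [|_ _ [q [b ->]] [r [c' ->]]|_ [b _ <-]].
  - by exists 0, 0; rewrite mulr0z add0r raddf0.
  - by exists (q - r), (b - c'); rewrite mulrzBr raddfB opprD addrACA.
  - by exists 1, b; rewrite (lam_bmul circC).
suff H k : (k <= n)%N -> forall c, exists v, brace_eval v = iter (n - k) D c.
  by have := H n (leqnn n) a; rewrite subnn.
elim: k => [_ c|k IHk kn c]; first by exists 0; rewrite subn0 nilp raddf0.
have [q [c' ->]] := split_gen c; have [w wE] := IHk (ltnW kn) c'.
have ikn : (n - k.+1 < n)%N by rewrite ltn_subrL.
exists (delta_mx ord0 (Ordinal ikn) *~ q + w).
rewrite raddfD raddfMz /= wE brace_eval_delta /= iter_bmulD iter_bmulMz.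
by rewrite -iterSr -subSn.
Qed.

Lemma presents_card (S : ybmap) (f : A -> S) m (b : 'I_n -> 'rV[int]_n) : presents y 0 f ->
  hermite [set v | brace_eval v = 0] m b ->
  forall i, finite_set [set: iter i Ret S] /\
    yb_card (iter i Ret S) = (\prod_(j < n | (i <= j)%N) m j)%N.
Proof.
move=> Pf Lmb i; have [g Pg] := presents_iter_Ret circC i Pf.
apply: (hermite_card (f := g \o brace_eval) Lmb) => [s|v w] /=.
  have [a <-] := presents_surj Pg s.
  by have [v <-] := brace_eval_surj a; exists v.
by rewrite (presents_ker Pg) -raddfB iter_brace_eval.
Qed.
End Generator.

(** Both braces are the same quotient of the row lattice, and [row_sigma] induces both maps
    [brace_sigma]. *)
Lemma brace_iso (A B : braceType) (x : A) (y : B) (n : nat) (n_gt0 : (0 < n)%N) :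
  (forall a b : A, (a * b)%g = (b * a)%g) -> (forall a b : B, (a * b)%g = (b * a)%g) ->
  (forall a, iter n (bmul x) a = 0) -> (forall b, iter n (bmul y) b = 0) ->
  (forall a, exists v, brace_eval x (n := n) v = a) ->
  (forall b, exists v, brace_eval y (n := n) v = b) ->
  (forall v, brace_eval x (n := n) v = 0 <-> brace_eval y (n := n) v = 0) ->
  exists2 h : A -> B, bijective h &
    forall a b, h (brace_sigma x a b) = brace_sigma y (h a) (h b).
Proof.
move=> AC BC nilA nilB /choice[u uE] /choice[w wE] ker.
have kerE (v v' : 'rV[int]_n) :
    brace_eval x v = brace_eval x v' <-> brace_eval y v = brace_eval y v'.
  by rewrite !brace_eval_eq.
exists (fun a => brace_eval y (u a)).
  exists (fun b => brace_eval x (w b)) => [a|b].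
    by rewrite -[RHS]uE; apply/kerE; rewrite wE.
  by rewrite -[RHS]wE; apply/kerE; rewrite uE.
move=> a b; rewrite (brace_sigma_eval BC nilB n_gt0).
by apply/kerE; rewrite uE -(brace_sigma_eval AC nilA) !uE.
Qed.

(** * The brace F_n / I_M and its lattice of relations *)

Section QuotientOfFn.
Import Quotient.
Variable n : nat.

Lemma Fn_row_inj (v : 'rV[int]_n) : Fn_row v = 0 -> v = 0.
Proof.
move=> /(congr1 (@Fn_val n)) /= v0; pose q : {poly int} := \sum_(j < n) v ord0 j *: 'X^(j.+1).
have qE : in_qpoly 'X^(n.+1) q = 0 :> {poly %/ ('X^(n.+1) : {poly int})}.
  rewrite -[RHS]v0 raddf_sum; apply: eq_bigr => j _.
  by rewrite /= in_qpolyZ; congr (_ *: _); exact: (rmorphXn (in_qpoly _)).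
have size_q : (size q < size (mk_monic ('X^(n.+1) : {poly int})))%N.
  rewrite mk_monic_Xn size_polyXn ltnS (leq_trans (size_sum _ _ _)) //.
  apply/bigmax_leqP => j _; rewrite (leq_trans (size_scale_leq _ _)) // size_polyXn.
  by rewrite ltnS.
have q0 : q = 0 by rewrite -(in_qpoly_small size_q) qE.
apply/rowP => j; rewrite mxE; have := congr1 (fun r : {poly int} => r`_j.+1) q0.
rewrite /q coef_sum coef0 (bigD1 j) //= coefZ coefXn eqxx mulr1 big1 ?addr0 // => k kj.
by rewrite coefZ coefXn eqSS eq_sym val_eqE (negPf kj) mulr0.
Qed.

Lemma Fn_factor (a : Fn n) : exists f, (a : {poly %/ ('X^(n.+1) : {poly int})}) = 'qX * f.
Proof.
have /set_mem/(_ [set g | exists f, g = 'qX * f]) := valP a.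
apply; split=> [|_ ->]; last by exists 1; rewrite mulr1.
split; first split; first by apply/mem_set; exists 0; rewrite mulr0.
- move=> u v /set_mem[f ->] /set_mem[g ->]; apply/mem_set.
  by exists (f - g); rewrite mulrBr.
- move=> u v /set_mem[f ->] /set_mem[g ->]; apply/mem_set.
  by exists (f * ('qX * g)); rewrite -mulrA.
Qed.

(** Elements of F_n are already divisible by x, so n further factors reach x^(n+1). *)
Lemma iter_Fn_mul_x (a : Fn n) : iter n (Fn_mul (Fn_x n)) a = 0.
Proof.
apply: val_inj => /=; have [f aE] := Fn_factor a.
have -> i : Fn_val (iter i (Fn_mul (Fn_x n)) a) = 'qX ^+ i * Fn_val a.
  by elim: i => [|i IHi]; rewrite ?expr0 ?mul1r //= IHi mulrA -exprS.
by rewrite aE mulrA -exprSr qX_nilp mul0r.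
Qed.

Variables (p : nat) (d : 'I_n -> nat) (M : calM p d).
Local Notation A := (Fn_mod M).
Local Notation y := (Fn_mod_x M).
Local Notation piM := (\pi_(quot (I_M M : braceIdeal (Fn n)))%qT).

Lemma Fn_mod_circC (a b : A) : (a * b)%g = (b * a)%g.
Proof.
elim/quotP: a => a _; elim/quotP: b => b _.
by rewrite !pi_mulg; congr (piM _); exact: Fn_circC.
Qed.

Lemma bmul_Fn_mod (a : Fn n) : bmul y (piM a : A) = piM (Fn_mul (Fn_x n) a).
Proof.
rewrite bmulE /Fn_mod_x (pi_mulg _ (Fn_x n) a) -!raddfB; congr (piM _).
rewrite -[(Fn_x n * a)%g]/(Fn_x n + Fn_mul (Fn_x n) a + a).
by rewrite addrAC addrK addrAC subrr add0r.
Qed.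

Lemma iter_bmul_Fn_mod i (a : Fn n) :
  iter i (bmul y) (piM a : A) = piM (iter i (Fn_mul (Fn_x n)) a).
Proof. by elim: i => //= i ->; rewrite bmul_Fn_mod. Qed.

Lemma Fn_mod_nilp (a : A) : iter n (bmul y) a = 0.
Proof.
elim/quotP: a => a _; rewrite iter_bmul_Fn_mod iter_Fn_mul_x.
exact: raddf0.
Qed.

Lemma Fn_mod_gen : gen_zmod [set lam a y | a in [set: A]] = [set: A].
Proof.
have [B [[y' BE] genB]] := Fn_mod_x_cycle_base M.
rewrite BE => -[a0 _ y'E]; apply/seteqP; split=> // c _.
have : gen_zmod B c by rewrite genB.
rewrite BE; apply: gen_zmod_sub => [||_ [a _ <-]]; [exact: gen_zmod0 | exact: gen_zmodB |].
apply: sub_gen_smallest; exists (a * a0^-1)%g => //.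
by rewrite -y'E -lamM mulgVK.
Qed.

Hypothesis n_gt0 : (0 < n)%N.

HB.instance Definition _ :=
  GRing.isZmodMorphism.Build 'rV[int]_n (Fn n) (@Fn_row n) (@Fn_rowB n).

Lemma Fn_x_row : Fn_x n = Fn_row (delta_mx ord0 (Ordinal n_gt0)).
Proof.
apply: val_inj => /=; rewrite (bigD1 (Ordinal n_gt0)) //= mxE !eqxx scale1r expr1.
rewrite big1 ?addr0 // => j jn; rewrite mxE (negPf jn) andbF scale0r //.
Qed.

Lemma Fn_mod_eval v : brace_eval y v = piM (Fn_row v).
Proof.
have deltaE (j : 'I_n) : iter j (bmul y) y = piM (Fn_row (delta_mx ord0 j)).
  have yE : y = piM (Fn_row (delta_mx ord0 (Ordinal n_gt0))).
    by rewrite /Fn_mod_x Fn_x_row.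
  have iE i w : iter i (bmul y) (piM (Fn_row w) : A) = piM (Fn_row (iter i (@shift_row n) w)).
    by elim: i => //= i ->; rewrite bmul_Fn_mod Fn_mul_x_row.
  apply: etrans (etrans (congr1 (iter j (bmul y)) yE) (iE j _)) _.
  congr (piM (Fn_row _)); apply/rowP => k.
  have [kj|jk] := ltnP k j.
    rewrite (@iter_shift_lt _ j) // mxE andTb.
    by case: eqP kj => // ->; rewrite ltnn.
  have kn : (k - j < n)%N by rewrite (leq_ltn_trans (leq_subr j k)).
  rewrite (iter_shift_add _ (j' := Ordinal kn)) /= ?subnKC // !mxE.
  by congr (nat_of_bool _)%:R; rewrite -!val_eqE /= subn_eq0 [RHS]eqn_leq jk andbT.
rewrite /brace_eval; under eq_bigr => j _ do rewrite deltaE -raddfMz -raddfMz.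
rewrite -!raddf_sum; congr (piM (Fn_row _)).
rewrite [RHS](row_sum_delta v); apply: eq_bigr => j _.
by rewrite -scaler_int intz.
Qed.

(** [Fn_row] is additive and injective, so membership in [I_M] can be tested on rows. *)
Lemma Fn_mod_ker v :
  brace_eval y v = 0 <-> gen_zmod [set row k M | k in [set: 'I_n]] v.
Proof.
rewrite Fn_mod_eval.
have -> : (piM (Fn_row v) = 0 :> A) <-> Fn_row v \in I_M M.
  rewrite -[X in _ = X](raddf0 piM) (quot_pi_eq (I_M M : braceIdeal (Fn n))) subr0.
  by [].
split=> [/set_mem|Lv].
  suff sub : gen_zmod [set Fn_row (row k M) | k in [set: 'I_n]] `<=`
      [set Fn_row w | w in gen_zmod [set row k M | k in [set: 'I_n]]].
    move=> /sub[w Lw wv]; suff -> : v = w by [].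
    by apply/subr0_eq/Fn_row_inj; rewrite raddfB /= wv subrr.
  apply: gen_zmod_sub => [|_ _ [u Lu <-] [w Lw <-]|_ [k _ <-]].
  - by exists 0; [exact: gen_zmod0 | exact: raddf0].
  - by exists (u - w); [exact: gen_zmodB | exact: raddfB].
  - by exists (row k M) => //; apply: sub_gen_smallest; exists k.
apply/mem_set; move: v Lv.
apply: (gen_zmod_sub (H := [set v | gen_zmod _ (Fn_row v)])) => [|u w Lu Lw|_ [k _ <-]] /=.
- by rewrite raddf0; exact: gen_zmod0.
- by rewrite raddfB; exact: gen_zmodB.
- by apply: sub_gen_smallest; exists k.
Qed.
End QuotientOfFn.

(** * Cardinalities of the retracts and the two implications *)

Lemma finite_zmod_exponent (V : zmodType) :
  finite_set [set: V] -> exists2 N, (0 < N)%N & forall v : V, v *+ N = 0.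
Proof.
move=> finV; pose F := fset_set [set: V].
have inF v : v \in F by rewrite in_fset_set ?inE.
exists #|` F|%N => [|v]; first by rewrite cardfs_gt0; apply/fset0Pn; exists 0; exact: inF.
(* Translation by v permutes V; comparing the sums over V gives |V| v = 0. *)
have permF : perm_eq [seq v + w | w <- F] F.
  apply: uniq_perm => [||w]; [|exact: fset_uniq|].
    by rewrite map_inj_uniq ?fset_uniq //; exact: addrI.
  rewrite inF; apply/mapP; exists (w - v); first exact: inF.
  by rewrite addrC subrK.
have := perm_big _ permF : \sum_(w <- _) w = \sum_(w <- _) w.
rewrite big_map big_split /= => /(canRL (addrK _)); rewrite subrr.
by rewrite big_const_seq count_predT iter_addr_0 => ->.
Qed.

Section Index.
Variables (n : nat) (m : 'I_n -> nat) (m_gt0 : forall i, (0 < m i)%N).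
Variables (S : ybmap)
  (card_Ret : forall i, yb_card (iter i Ret S) = (\prod_(j < n | (i <= j)%N) m j)%N).

Lemma yb_card_ratio (i : 'I_n) :
  (yb_card (iter i Ret S))%:R / (yb_card (iter i.+1 Ret S))%:R = (m i)%:R :> rat.
Proof.
rewrite !card_Ret (bigD1 i) //= natrM.
have -> : (\prod_(j < n | (i <= j)%N && (j != i)) m j =
    \prod_(j < n | (i < j)%N) m j)%N.
  by apply: eq_bigl => j; rewrite [RHS]ltn_neqAle andbC eq_sym.
by rewrite mulfK // pnatr_eq0 -lt0n prodn_gt0.
Qed.

Lemma yb_card_last : yb_card (iter n Ret S) = 1%N.
Proof. by rewrite card_Ret big1 // => j nj; have := ltn_ord j; rewrite ltnNge nj. Qed.
End Index.

Lemma Fn_mod_AbSol (p n : nat) (d : 'I_n -> nat) (M : calM p d) :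
  prime p -> (0 < n)%N -> AbSol (fun i => (p ^ d i)%N) (brace_yb (Fn_mod_x M)).
Proof.
move=> p_prime n_gt0.
have LM : hermite [set v | brace_eval (Fn_mod_x M) v = 0] (fun i => p ^ d i)%N
    (fun i => row i M).
  have -> : [set v | brace_eval (Fn_mod_x M) v = 0] =
      gen_zmod [set row k M | k in [set: 'I_n]].
    by apply/seteqP; split=> v /=; rewrite Fn_mod_ker.
  exact: calM_hermite.
have circC := @Fn_mod_circC _ _ _ M; have nilp := @Fn_mod_nilp _ _ _ M.
have card := presents_card circC nilp n_gt0 (Fn_mod_gen M) (presents_brace _) LM.
have finA : finite_set [set: Fn_mod M] by have [] := card 0.
split.
- by split; [exact: (brace_yb_solution circC nilp finA) | exact: finA].
- exact: (brace_yb_indecomposable (Fn_mod_gen M)).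
- exact: brace_yb_involutive.
- exact: (brace_yb_abelian circC nilp).
- have cardE i := (card i).2; split=> [i|].
    exact: (yb_card_ratio (hermite_gt0 LM) cardE).
  exact: (yb_card_last cardE).
Qed.

Lemma AbSol_iso (p n : nat) (d : 'I_n -> nat) (S : ybmap) :
  prime p -> (0 < n)%N -> AbSol (fun i => (p ^ d i)%N) S ->
  exists M : calM p d, yb_iso S (brace_yb (Fn_mod_x M)).
Proof.
move=> p_prime n_gt0 [[solS finS] indecS invS abelS [ratioS lastS]].
have [A [y [h [circC gen h_bij hE]]]] := solution_brace solS invS indecS abelS.
have tauE a b : tau (h b) (h a) = h (brace_tau y b a).
  apply: (bij_inj (sigma_bij solS (sigma (h a) (h b)))).
  by rewrite (sigmaK invS) -hE -hE sigma_tau.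
have Pf : presents y 0 h.
  split=> [s|a b|a b|//]; last by rewrite hE.
    by have [h' _ hh'] := h_bij; exists (h' s).
  by split=> [/(bij_inj h_bij)->|/subr0_eq->//]; rewrite subrr.
have [h' hh' h'h] := h_bij.
have finA : finite_set [set: A].
  have -> : [set: A] = h' @` [set: S].
    by apply/seteqP; split=> // a _; exists (h a).
  exact: finite_image.
(* The n-th retract is a single point, so a and 0 have the same class in it. *)
have nilp a : iter n (bmul y) a = 0.
  have [g Pg] := presents_iter_Ret circC n Pf.
  rewrite -[a]subr0; apply/(presents_ker Pg).
  have finR : finite_set [set: iter n Ret S].
    have -> : [set: iter n Ret S] = g @` [set: A].
      by apply/seteqP; split=> // s _; have [b <-] := presents_surj Pg s; exists b.
    exact: finite_image.
  have /eqP := lastS; rewrite /yb_card => /cardfs1P[s sE].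
  have all_s t : t = s.
    have : t \in fset_set [set: iter n Ret S] by rewrite in_fset_set ?inE.
    by rewrite sE inE => /eqP.
  by rewrite (all_s (g a)) (all_s (g 0)).
have surj := brace_eval_surj circC nilp n_gt0 gen.
pose L := [set v : 'rV[int]_n | brace_eval y v = 0].
have [N N_gt0 NE] := finite_zmod_exponent finA.
have [m [b Lmb]] : exists m b, hermite L m b.
  apply: (@hermite_exists _ _ N) => // [|u v|v]; rewrite /L /= ?raddf0 //.
    by rewrite raddfB /= => -> ->; rewrite subrr.
  by rewrite raddfMn /= NE.
have card i := (presents_card circC nilp n_gt0 gen Pf Lmb i).2.
(* The ratios of successive retract sizes are the diagonal of any triangular basis. *)
have mE : m = (fun i => p ^ d i)%N.
  apply/funext => i; apply/eqP; rewrite -(eqr_nat rat) -ratioS.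
  by rewrite -(yb_card_ratio (hermite_gt0 Lmb) card).
rewrite mE in Lmb.
have [|M LM] := hermite_calM p_prime Lmb.
  by move=> v; rewrite /L /= -bmul_brace_eval // => ->; rewrite raddf0.
exists M; have [k k_bij kE] : exists2 k : A -> Fn_mod M, bijective k &
    forall a b, k (brace_sigma y a b) = brace_sigma (Fn_mod_x M) (k a) (k b).
  have circM := @Fn_mod_circC _ _ _ M; have nilM := @Fn_mod_nilp _ _ _ M.
  apply: (brace_iso n_gt0) => // [|v].
    exact: (brace_eval_surj circM nilM n_gt0 (Fn_mod_gen M)).
  by rewrite Fn_mod_ker // -LM.
exists (k \o h'); split=> [|x z].
  by apply: bij_comp => //; exists h.
set f := k \o h'; pose w := Fn_mod_x M.
have fsigma u v : f (sigma u v) = brace_sigma w (f u) (f v).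
  by rewrite -[in LHS](h'h u) -[in LHS](h'h v) -hE /f /= hh' kE.
change ((f (sigma x z), f (tau z x)) =
  (brace_sigma w (f x) (f z), brace_sigma_inv w (brace_sigma w (f x) (f z)) (f x))).
(* On both sides involutivity determines [tau] from [sigma]. *)
rewrite -fsigma; congr pair; apply: (can_inj (brace_sigmaK w (f (sigma x z)))).
by rewrite brace_sigma_invK -fsigma sigmaK.
Qed.

Theorem theorem7p16 (p n : nat) (d : 'I_n -> nat)
    (p_prime : prime p) (n_gt0 : (0 < n)%N)
    (d_noninc : forall i j : 'I_n, (i <= j)%N -> (d j <= d i)%N) :
  (forall M : calM p d,
     AbSol (fun i => (p ^ d i)%N) (brace_yb (Fn_mod_x M))) /\
  (forall S : ybmap, AbSol (fun i => (p ^ d i)%N) S ->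
     exists M : calM p d, yb_iso S (brace_yb (Fn_mod_x M))).
Proof. by split=> [M|S]; [exact: Fn_mod_AbSol | exact: AbSol_iso]. Qed.
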